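(* Let all distributions in $\mathcal M$ be equivalent (pairwise mutually absolutely continuous). Let $K:\mathcal X\times\mathcal X\to\mathbb R$ be a bounded, symmetric, positive-definite kernel on a set $\mathcal X$, and let $\mathcal W$ be the unique reproducing kernel Hilbert space associated with $K$. Let $m\in(0,\infty)$, let $Q_X\in\{P'_X:P'\in\mathcal M\}$, and let $\mathcal U:=\{u\in L^2(\rho_X):\|u\|_{L^\infty(\rho_X)}\le m\}$, viewed as a subset of the ambient Hilbert space $L^2(Q_X)$. Define $\theta:\mathcal M\times\mathcal U\to\mathcal W$ by the Bochner integral $\theta(P',u')(\cdot)=\int K(\cdot,x)\,u'(x)\,P'_X(dx)$. Fix $(P,u)\in\mathcal M\times\mathcal U$, and suppose that $\mathcal M$ is locally nonparametric at $P$ and that $\|dP_X/dQ_X\|_{L^\infty(Q_X)}<\infty$. Then $\theta$ is totally pathwise differentiable at $(P,u)$ with $$\dot\theta_{P,u}(s,t)(\cdot)=E_P\big[K(\cdot,X)\{u(X)s(Z)+t(X)\}\big]$$ and $\dot\theta_{P,u}^*(w)=(\dot\nu_{P,u}^*(w),\dot\zeta_{P,u}^*(w))$, where $$\dot\nu_{P,u}^*(w)(z)=w(x)u(x)-E_P[w(X)u(X)]\ \text{ with }x:=\mathscr C(z),\qquad \dot\zeta_{P,u}^*(w)(x)=w(x)\,\frac{dP_X}{dQ_X}(x).$$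
   Context: All Hilbert spaces are real. $\mathcal M$ is a set of probability distributions on a measurable space $\mathcal Z$. $X=\mathscr C(Z)$ for a coarsening (a many-to-one map) $\mathscr C:\mathcal Z\to\mathcal X$; $P_X=P\circ\mathscr C^{-1}$ is the law of $X$ when $Z\sim P$. $\rho$ is an arbitrarily selected distribution in $\mathcal M$ and $\rho_X=\rho\circ\mathscr C^{-1}$; since all distributions in $\mathcal M$ are equivalent, $\rho_X$-a.s. and $Q_X$-a.s. equivalence classes coincide. For $P\in\mathcal M$ and $s\in L^2(P)$, $\mathscr P(P,\mathcal M,s)$ is the collection of submodels $\{P_\epsilon:\epsilon\in[0,1]\}\subseteq\mathcal M$ with $P_{\epsilon=0}=P$ that are quadratic mean differentiable with score $s$ at $\epsilon=0$, i.e. $\int(\sqrt{dP_\epsilon}-\sqrt{dP}-\tfrac{\epsilon}{2}s\sqrt{dP})^2=o(\epsilon^2)$ as $\epsilon\to0$. The tangent set is $\check{\mathcal M}_P=\{s\in L^2(P):\mathscr P(P,\mathcal M,s)\neq\emptyset\}$ and the tangent space $\dot{\mathcal M}_P$ is the $L^2(P)$-closure of its linear span. $\mathcal M$ is locally nonparametric at $P$ if $\dot{\mathcal M}_P=\{s\in L^2(P):\int s\,dP=0\}$. For a subset $\mathcal U$ of a Hilbert space $\mathcal T$, $u\in\mathcal U$, $t\in\mathcal T$, $\mathscr P(u,\mathcal U,t)$ is the set of paths $\{u_\epsilon:\epsilon\in[0,1]\}\subseteq\mathcal U$ with $\|u_\epsilon-u-\epsilon t\|_{\mathcal T}=o(\epsilon)$;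 $\check{\mathcal U}_u=\{t\in\mathcal T:\mathscr P(u,\mathcal U,t)\ne\emptyset\}$ and $\dot{\mathcal U}_u$ is the $\mathcal T$-closure of its linear span. A map $\theta:\mathcal M\times\mathcal U\to\mathcal W$ ($\mathcal U\subseteq\mathcal T$; $\mathcal T,\mathcal W$ Hilbert) is totally pathwise differentiable at $(P,u)$ if there is a continuous linear $\dot\theta_{P,u}:\dot{\mathcal M}_P\oplus\dot{\mathcal U}_u\to\mathcal W$ such that for all $s\in\check{\mathcal M}_P$, $t\in\check{\mathcal U}_u$, $\{P_\epsilon\}\in\mathscr P(P,\mathcal M,s)$, $\{u_\epsilon\}\in\mathscr P(u,\mathcal U,t)$, $\|\theta(P_\epsilon,u_\epsilon)-\theta(P,u)-\epsilon\,\dot\theta_{P,u}(s,t)\|_{\mathcal W}=o(\epsilon)$. Its Hermitian adjoint is $\dot\theta_{P,u}^*:\mathcal W\to\dot{\mathcal M}_P\oplus\dot{\mathcal U}_u$. Here $\mathcal T=L^2(Q_X)$ and $\mathcal W$ is the RKHS of $K$. *)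

(* Defs.v *)
From HB Require Import structures.
From mathcomp Require Import all_boot all_order all_algebra.
From mathcomp Require Import all_classical all_reals all_analysis.

Set Implicit Arguments.
Unset Strict Implicit.
Unset Printing Implicit Defensive.

Import Order.TTheory GRing.Theory Num.Theory.
Import numFieldNormedType.Exports.

Local Open Scope classical_set_scope.
Local Open Scope ring_scope.

HB.mixin Record CompleteNormedModule_isHilbert (R : realType) H
    of CompleteNormedModule R H := {
  inner : H -> H -> R ;
  innerC : forall x y, inner x y = inner y x ;
  innerDZl : forall a x y z, inner (a *: x + y) z = a * inner x z + inner y z ;
  inner_norm : forall x, inner x x = `|x| ^+ 2
}.

#[short(type="hilbertType")]
HB.structure Definition Hilbert (R : realType) :=
  {H of CompleteNormedModule_isHilbert R H & CompleteNormedModule R H}.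

(* "Positive-definite" in the sense used for reproducing kernels: all Gram
   matrices are positive semidefinite. *)
Definition posdef_kernel (R : realType) (X : Type) (K : X -> X -> R) : Prop :=
  forall (n : nat) (x : 'I_n -> X) (c : 'I_n -> R),
    0 <= \sum_(i < n) \sum_(j < n) c i * c j * K (x i) (x j).

(* A Hilbert space of functions X -> R (an element [w] is identified with the
   function [ev w]) that contains every K(., x) and in which these reproduce
   point evaluation.  For a symmetric positive-definite K there is exactly one
   up to an isometry commuting with [ev]. *)
Record rkhs (R : realType) (X : Type) (K : X -> X -> R) := Rkhs {
  rkhs_space :> hilbertType R ;
  ev : rkhs_space -> X -> R ;
  ev_linear : forall a w1 w2 x, ev (a *: w1 + w2) x = a * ev w1 x + ev w2 x ;
  ev_inj : injective ev ;
  ksec : X -> rkhs_space ;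
  ev_ksec : forall x y, ev (ksec x) y = K y x ;
  inner_ksec : forall w x, inner w (ksec x) = ev w x
}.

Section bochner.
Context d (T : measurableType d) (R : realType) (W : completeNormedModType R).
Variable mu : {finite_measure set T -> \bar R}.

(* The sequence (A_i, c_i) stands for the simple function \sum_i 1_{A_i} c_i. *)
Definition simple := seq (set T * W).

Definition measurable_simple (S : simple) : Prop :=
  forall p, p \in S -> measurable p.1.

Definition simple_fun (S : simple) (z : T) : W :=
  \sum_(p <- S) (\1_(p.1) z : R) *: p.2.

Definition simple_integral (S : simple) : W :=
  \sum_(p <- S) fine (mu p.1) *: p.2.

Definition is_bochner_integral (f : T -> W) (w : W) : Prop :=
  exists S : nat -> simple,
    [/\ forall n, measurable_simple (S n),
        {ae mu, forall z, simple_fun (S n) z @[n --> \oo] --> f z},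
        (\int[mu]_z (`|simple_fun (S n) z - f z|)%:E)%E @[n --> \oo] --> 0%E &
        simple_integral (S n) @[n --> \oo] --> w].

Definition bochner_integrable (f : T -> W) : Prop :=
  exists w, is_bochner_integral f w.

Definition bochner (f : T -> W) : W := xget 0 [set w | is_bochner_integral f w].

End bochner.

(* r(eps) = o(eps ^ k) as eps tends to 0 within [0, 1]; this is the definition
   behind the library's [=o_(0^'+)], for a nonnegative r that may be +oo. *)
Definition little_o (R : realType) (k : nat) (r : R -> \bar R) : Prop :=
  forall e : R, 0 < e ->
    \forall eps \near 0^'+, (r eps <= (e * eps ^+ k)%:E)%E.

(* An element of L^2(mu) is represented by a measurable square-integrable
   function; sets of such functions and maps out of them are meant up to
   mu-a.e. equality. *)

Section L2.
Context d (T : measurableType d) (R : realType).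
Variable mu : {measure set T -> \bar R}.

Definition L2norm (f : T -> R) : \bar R := ('N[mu]_2%:E [EFin \o f])%E.

Definition L2closed_span (A : set (T -> R)) : set (T -> R) :=
  [set f | f \in Lfun mu 2%:E /\
    forall e : R, 0 < e ->
      exists (n : nat) (c : 'I_n -> R) (g : 'I_n -> T -> R),
        (forall i, A (g i)) /\
        (L2norm (fun z => f z - \sum_(i < n) c i * g i z)%R < e%:E)%E].

Definition L2_paths (U : set (T -> R)) (u t : T -> R) : set (R -> T -> R) :=
  [set ue | (forall eps, 0 <= eps <= 1 -> U (ue eps)) /\
    little_o 1 (fun eps => L2norm (fun x => ue eps x - u x - eps * t x))].

Definition L2_tangent_set (U : set (T -> R)) (u : T -> R) : set (T -> R) :=
  [set t | t \in Lfun mu 2%:E /\ L2_paths U u t !=set0].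

Definition L2_tangent_space (U : set (T -> R)) (u : T -> R) : set (T -> R) :=
  L2closed_span (L2_tangent_set U u).

Definition Linfty_ball (m : R) : set (T -> R) :=
  [set u | u \in Lfun mu 2%:E /\ ('N[mu]_+oo [EFin \o u] <= m%:E)%E].

End L2.

Section model.
Context d (Z : measurableType d) (R : realType).
Implicit Types (M : set (probability Z R)) (P : probability Z R) (s : Z -> R).

Definition density P (mu : {sigma_finite_measure set Z -> \bar R}) (z : Z) : R :=
  fine (Radon_Nikodym (charge_of_finite_measure P) mu z).

(* The integral of (sqrt dP_eps - sqrt dP - eps/2 s sqrt dP)^2 is computed from
   densities with respect to a dominating measure mu, on the choice of which
   it does not depend. *)
Definition qmd_submodels M P s : set (R -> probability Z R) :=
  [set Pe | [/\ forall eps, 0 <= eps <= 1 -> M (Pe eps),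
                Pe 0 = P &
      exists mu : {sigma_finite_measure set Z -> \bar R},
        (forall eps, 0 <= eps <= 1 -> Pe eps `<< mu) /\
        little_o 2 (fun eps => \int[mu]_z
          ((Num.sqrt (density (Pe eps) mu z) - Num.sqrt (density P mu z)
            - eps / 2 * s z * Num.sqrt (density P mu z)) ^+ 2)%R%:E)%E]].

Definition tangent_set M P : set (Z -> R) :=
  [set s | s \in Lfun P 2%:E /\ qmd_submodels M P s !=set0].

Definition tangent_space M P : set (Z -> R) :=
  L2closed_span P (tangent_set M P).

Definition locally_nonparametric M P : Prop :=
  tangent_space M P =
    [set s | s \in Lfun P 2%:E /\ (\int[P]_z (s z)%:E = 0)%E].

End model.

Section total_pathwise_differentiability.
Context d d' (Z : measurableType d) (X : measurableType d') (R : realType).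
Variables (W : hilbertType R).
Variables (M : set (probability Z R)) (U : set (X -> R)) (Q : probability X R).
Variables (P : probability Z R) (u : X -> R).

Definition sum_tangent : set ((Z -> R) * (X -> R)) :=
  tangent_space M P `*` L2_tangent_space Q U u.

Definition sum_inner (p q : (Z -> R) * (X -> R)) : R :=
  \int[P]_z (p.1 z * q.1 z) + \int[Q]_x (p.2 x * q.2 x).

Definition sum_dist (p q : (Z -> R) * (X -> R)) : R :=
  Num.sqrt (fine (L2norm P (fun z => p.1 z - q.1 z)) ^+ 2 +
            fine (L2norm Q (fun x => p.2 x - q.2 x)) ^+ 2).

Definition linear_on_tangent (D : (Z -> R) * (X -> R) -> W) : Prop :=
  forall a p q, sum_tangent p -> sum_tangent q ->
    D (fun z => a * p.1 z + q.1 z, fun x => a * p.2 x + q.2 x) =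
    a *: D p + D q.

(* Taking sum_dist p q = 0, this also forces D to be well defined on classes of
   a.e. equal functions. *)
Definition continuous_on_tangent (D : (Z -> R) * (X -> R) -> W) : Prop :=
  forall p, sum_tangent p -> forall e : R, 0 < e ->
    exists2 delta : R, 0 < delta &
      forall q, sum_tangent q -> sum_dist p q < delta -> `|D p - D q| < e.

Definition is_total_derivative (theta : probability Z R -> (X -> R) -> W)
    (D : (Z -> R) * (X -> R) -> W) : Prop :=
  [/\ linear_on_tangent D, continuous_on_tangent D &
      forall s t Pe ue,
        tangent_set M P s -> L2_tangent_set Q U u t ->
        qmd_submodels M P s Pe -> L2_paths Q U u t ue ->
        little_o 1 (fun eps =>
          `|theta (Pe eps) (ue eps) - theta P u - eps *: D (s, t)|%:E)].

Definition is_adjoint (D : (Z -> R) * (X -> R) -> W)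
    (Dstar : W -> (Z -> R) * (X -> R)) : Prop :=
  forall w, sum_tangent (Dstar w) /\
    forall p, sum_tangent p -> inner (D p) w = sum_inner p (Dstar w).

End total_pathwise_differentiability.

Definition kernel_embedding d d' (Z : measurableType d) (X : measurableType d')
    (R : realType) (K : X -> X -> R) (W : rkhs K) (C : {mfun Z >-> X})
    (P : probability Z R) (u : X -> R) : W :=
  bochner (distribution P C) (fun x => u x *: ksec W x).

(* Main.v *)
(** The operator [D (s, t) = E_P[(u s + t) K(., X)]] is a Bochner integral.
    Every identity or bound between Bochner integrals is tested against
    [w : W]: by reproduction, [inner (K(., x)) w = ev w x], so it becomes a
    statement about scalar integrals of the bounded function [ev w], uniform
    over the unit ball of [W].  The kernel need not be measurable, but its
    assumed Bochner integrability makes [x |-> K(., x)] an almost everywhere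
    limit of simple functions, and hence [ev w] almost everywhere equal to a
    measurable bounded function.

    With [a], [b] the square roots of the densities of [P_eps] and [P], and
    [r = a - b - (eps/2) s b] the quadratic mean remainder,
    [a^2 - b^2 - eps s b^2 = r (a + b) + (eps/2) s b r + (eps^2/4) s^2 b^2],
    whose L^1 norm is [o(eps)] because that of [r] in L^2 is.  Then
    [theta(P_eps, u_eps) - theta(P, u) - eps D(s, t)] splits into the integral
    of [u_eps] against this signed measure, the linear error
    [u_eps - u - eps t], and the product error [eps s (u_eps - u)]; the last two
    are transferred from [Q_X] to [P_X] by the bound on the density.

    The tangent space of the L^infinity ball contains every bounded function
    [t], since after scaling [t = (t - u) - (0 - u)] and both differences are
    directions of segments in the ball.  Together with local nonparametricity
    this places the candidate adjoint in the tangent space. *)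

Require Import Defs.
From HB Require Import structures.
From mathcomp Require Import all_boot all_order all_algebra.
From mathcomp Require Import all_classical all_reals all_analysis.
From mathcomp Require Import measurable_realfun ess_sup_inf ring lra.

Set Implicit Arguments.
Unset Strict Implicit.
Unset Printing Implicit Defensive.

Import Order.TTheory GRing.Theory Num.Theory.
Import numFieldNormedType.Exports.

Local Open Scope classical_set_scope.
Local Open Scope ring_scope.

(** * Integrals of possibly nonmeasurable functions, compared almost everywhere *)

Section lower_integral.
Context d (T : measurableType d) (R : realType) (mu : {measure set T -> \bar R}).
Import HBNNSimple.

(* No measurability is needed: the integral of a nonnegative function is a
   supremum over the nonnegative simple functions below it, and these may be
   set to 0 on the exceptional null set. *)
Lemma ae_ge0_le_lower_integral (f g : T -> \bar R) :
  (forall x, 0 <= f x)%E -> (forall x, 0 <= g x)%E ->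
  {ae mu, forall x, f x <= g x}%E ->
  (\int[mu]_x f x <= \int[mu]_x g x)%E.
Proof.
move=> f0 g0 [N [mN muN sN]].
rewrite !ge0_integralTE//.
apply: ge_ereal_sup => _ [h /= hf <-].
pose h' := proj_nnsfun h (measurableC mN).
have -> : sintegral mu h = sintegral mu h'.
  rewrite -!integralT_nnsfun; apply: ae_eq_integral => //.
  - exact/measurable_EFinP.
  - exact/measurable_EFinP.
  exists N; split=> // x /=; apply: contra_notP => Nx _.
  rewrite /h' /= mindicE mem_set ?mulr1//.
apply: ereal_sup_ubound; exists h' => //= x.
rewrite /h' /= mindicE; have [xN|xN] := boolP (x \in ~` N); last first.
  by rewrite mulr0.
rewrite mulr1 (le_trans (hf x))//.
by apply: contrapT => /sN; move: xN; rewrite inE.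
Qed.

(** Positive and negative parts are compared in both directions. Since no measurability is asked,
    this applies to integrands containing [ev w], which is only known to agree almost everywhere
    with a measurable function. *)
Lemma ae_eq_lower_Rintegral (f g : T -> R) :
  {ae mu, forall x, f x = g x} -> \int[mu]_x f x = \int[mu]_x g x.
Proof.
move=> fg; rewrite /Rintegral; congr fine.
rewrite integralE [RHS]integralE; congr (_ - _)%E; apply/eqP; rewrite eq_le;
  apply/andP; split; apply: ae_ge0_le_lower_integral => //;
  by apply: filterS fg => x; rewrite ?funeposE ?funenegE => ->.
Qed.

End lower_integral.

(** * Inner products, Cauchy-Schwarz and duality *)

Section hilbert_theory.
Context (R : realType) (H : hilbertType R).
Implicit Types (x y z : H) (a : R).

Lemma inner0l z : inner 0 z = 0.
Proof.
have := innerDZl 1 0 0 z; rewrite scaler0 add0r mul1r => /eqP.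
by rewrite -subr_eq0 opprD addrA subrr sub0r oppr_eq0 => /eqP.
Qed.

Lemma innerZl a x z : inner (a *: x) z = a * inner x z.
Proof. by rewrite -[a *: x]addr0 innerDZl inner0l addr0. Qed.

Lemma innerDl x y z : inner (x + y) z = inner x z + inner y z.
Proof. by rewrite -{1}[x]scale1r innerDZl mul1r. Qed.

Lemma innerNl x z : inner (- x) z = - inner x z.
Proof. by rewrite -scaleN1r innerZl mulN1r. Qed.

Lemma innerBl x y z : inner (x - y) z = inner x z - inner y z.
Proof. by rewrite innerDl innerNl. Qed.

Lemma innerZr a x z : inner z (a *: x) = a * inner z x.
Proof. by rewrite innerC innerZl innerC. Qed.

Lemma innerBr x y z : inner z (x - y) = inner z x - inner z y.
Proof. by rewrite innerC innerBl innerC [in X in _ - X]innerC. Qed.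

Lemma inner_suml (I : Type) (r : seq I) (F : I -> H) z :
  inner (\sum_(i <- r) F i) z = \sum_(i <- r) inner (F i) z.
Proof.
elim: r => [|i r IH]; first by rewrite !big_nil inner0l.
by rewrite !big_cons innerDl IH.
Qed.

Lemma cauchy_schwarz x y : `|inner x y| <= `|x| * `|y|.
Proof.
have [->|y0] := eqVneq y 0; first by rewrite innerC inner0l !normr0 mulr0.
have ny : 0 < `|y| ^+ 2 by rewrite exprn_gt0// normr_gt0.
rewrite -ler_sqr ?nnegrE ?mulr_ge0// real_normK ?num_real// exprMn.
(* This vector is [|y|^2] times the component of [x] orthogonal to [y]; scaling by [|y|^2] avoids a
   division. *)
have : 0 <= inner (`|y| ^+ 2 *: x - inner x y *: y)
                 (`|y| ^+ 2 *: x - inner x y *: y).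
  by rewrite inner_norm sqr_ge0.
rewrite innerBl !innerBr !innerZl !innerZr !inner_norm (innerC y x).
set a := inner x y; set b := `|y| ^+ 2; set c := `|x| ^+ 2 => h.
have {}h : 0 <= b * (c * b - a ^+ 2) by move: h; congr (_ <= _); ring.
by move: h; rewrite pmulr_rge0// subr_ge0.
Qed.

(** Take [y = x]. This converts scalar bounds, linear in the norm of the test vector, into norm
    bounds on Bochner integrals. *)
Lemma inner_dual_norm_le x b : 0 <= b ->
  (forall y, `|inner x y| <= b * `|y|) -> `|x| <= b.
Proof.
move=> b0 /(_ x); rewrite inner_norm ger0_norm ?sqr_ge0// expr2.
have [->|x0] := eqVneq x 0; first by rewrite normr0.
by rewrite ler_pM2r// normr_gt0.
Qed.

Lemma inner_eq x y : (forall z, inner x z = inner y z) -> x = y.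
Proof.
move=> xy; apply/eqP; rewrite -subr_eq0 -normr_le0.
by apply: inner_dual_norm_le => // z; rewrite innerBl xy subrr normr0 mul0r.
Qed.

End hilbert_theory.

Lemma measurable_sqrt (R : realType) : measurable_fun setT (@Num.sqrt R).
Proof. by apply: continuous_measurable_fun; exact: sqrt_continuous. Qed.

(** * Integrability of real-valued functions under algebraic operations *)

Section real_integrability.
Context d (T : measurableType d) (R : realType) (mu : {measure set T -> \bar R}).
Implicit Types f g h : T -> R.

Lemma integrable_measurable f : mu.-integrable setT (EFin \o f) ->
  measurable_fun setT f.
Proof. by move=> /measurable_int/measurable_EFinP. Qed.

Lemma integrable_le f g : measurable_fun setT f ->
  mu.-integrable setT (EFin \o g) -> (forall x, `|f x| <= g x) ->
  mu.-integrable setT (EFin \o f).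
Proof.
move=> mf ig fg; apply: le_integrable ig => //; first exact/measurable_EFinP.
by move=> x _ /=; rewrite lee_fin (le_trans (fg x))// ler_norm.
Qed.

Lemma integrable_scale k f : mu.-integrable setT (EFin \o f) ->
  mu.-integrable setT (EFin \o (fun x => k * f x)).
Proof. by move=> i; exact: (integrableZl measurableT k i). Qed.

Lemma integrable_add f g : mu.-integrable setT (EFin \o f) ->
  mu.-integrable setT (EFin \o g) ->
  mu.-integrable setT (EFin \o (fun x => f x + g x)).
Proof. by move=> i j; exact: (integrableD measurableT i j). Qed.

Lemma integrable_sub f g : mu.-integrable setT (EFin \o f) ->
  mu.-integrable setT (EFin \o g) ->
  mu.-integrable setT (EFin \o (fun x => f x - g x)).
Proof. by move=> i j; exact: (integrableB measurableT i j). Qed.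

Lemma integrable_bounded_mul c f h : measurable_fun setT h ->
  (forall x, `|h x| <= c) -> mu.-integrable setT (EFin \o f) ->
  mu.-integrable setT (EFin \o (fun x => h x * f x)).
Proof.
move=> mh hc i; apply: (@integrable_le _ (fun x => c * `|f x|)).
- by apply: measurable_funM => //; exact: integrable_measurable.
- exact/integrable_scale/(integrable_norm i).
- by move=> x; rewrite normrM ler_wpM2r.
Qed.

End real_integrability.

(** * Bochner integrals in a Hilbert space *)

Section simple_functions.
Context d (T : measurableType d) (R : realType) (W : hilbertType R).
Variable mu : {finite_measure set T -> \bar R}.
Implicit Types (S : simple T W) (v : W) (z : T).

Lemma measurable_simple_cons p S : measurable_simple (p :: S) ->
  measurable p.1 /\ measurable_simple S.
Proof.
move=> mS; split; first by apply: mS; rewrite mem_head.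
by move=> q qS; apply: mS; rewrite inE qS orbT.
Qed.

Lemma inner_simple_fun S v z :
  inner (simple_fun S z) v = \sum_(p <- S) \1_(p.1) z * inner p.2 v.
Proof. by rewrite inner_suml; apply: eq_bigr => p _; rewrite innerZl. Qed.

Lemma measurable_inner_simple S v : measurable_simple S ->
  measurable_fun setT (fun z => inner (simple_fun S z) v).
Proof.
move=> mS; under eq_fun do rewrite inner_simple_fun.
elim: S mS => [_|p S IH /measurable_simple_cons[mp mS]].
  by under eq_fun do rewrite big_nil; exact: measurable_cst.
under eq_fun do rewrite big_cons.
apply: measurable_funD; last exact: IH.
by apply: measurable_funM => //; exact: measurable_indic.
Qed.

Lemma measurable_norm_simple S : measurable_simple S ->
  measurable_fun setT (fun z => `|simple_fun S z|).
Proof.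
move=> mS.
have -> : (fun z => `|simple_fun S z|) =
    @Num.sqrt R \o (fun z => inner (simple_fun S z) (simple_fun S z)).
  by apply/funext => z /=; rewrite inner_norm sqrtr_sqr normr_id.
apply: measurableT_comp; first exact: measurable_sqrt.
(* The left argument is generalised so that the induction runs on it while the right one stays
   fixed. *)
have h S' : measurable_simple S' ->
    measurable_fun setT (fun z => inner (simple_fun S' z) (simple_fun S z)).
  move=> mS'; under eq_fun do rewrite inner_simple_fun.
  elim: S' mS' => [_|p S' IH /measurable_simple_cons[mp mS']].
    by under eq_fun do rewrite big_nil; exact: measurable_cst.
  under eq_fun do rewrite big_cons.
  apply: measurable_funD; last exact: IH.
  apply: measurable_funM; first exact: measurable_indic.
  under eq_fun do rewrite innerC.
  exact: measurable_inner_simple.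
exact: h.
Qed.

Lemma norm_simple_le S z : `|simple_fun S z| <= \sum_(p <- S) `|p.2|.
Proof.
apply: (le_trans (ler_norm_sum _ _ _)); apply: ler_sum => p _.
rewrite normrZ -[leRHS]mul1r ler_wpM2r// indicE.
by case: (_ \in _); rewrite ?normr1// normr0.
Qed.

Lemma integrable_norm_simple S : measurable_simple S ->
  mu.-integrable setT (fun z => (`|simple_fun S z|)%:E).
Proof.
move=> mS; apply: (@le_integrable _ _ _ _ _ measurableT _
    (cst (\sum_(p <- S) `|p.2|)%:E)).
- exact/measurable_EFinP/measurable_norm_simple.
- move=> z _ /=; rewrite lee_fin normr_id ger0_norm ?norm_simple_le//.
  by apply: sumr_ge0.
- exact: finite_measure_integrable_cst.
Qed.

Lemma integral_inner_simple S v : measurable_simple S ->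
  mu.-integrable setT (fun z => (inner (simple_fun S z) v)%:E) /\
  \int[mu]_z (inner (simple_fun S z) v) = inner (simple_integral mu S) v.
Proof.
move=> mS; rewrite /simple_integral inner_suml.
under eq_fun do rewrite inner_simple_fun.
under eq_Rintegral do rewrite inner_simple_fun.
elim: S mS => [_|p S IH /measurable_simple_cons[mp mS]].
  rewrite big_nil; split.
    by under eq_fun do rewrite big_nil; exact: integrable0.
  under eq_Rintegral do rewrite big_nil.
  by rewrite Rintegral_cst// mul0r.
have [iS eS] := IH mS.
have ip : mu.-integrable setT (fun z => (\1_(p.1) z * inner p.2 v)%:E).
  under eq_fun do rewrite mulrC EFinM.
  by apply: integrableZl => //; exact: integrable_indic.
split.
  under eq_fun do rewrite big_cons.
  exact: integrable_add.
under eq_Rintegral do rewrite big_cons.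
rewrite RintegralD// eS big_cons; congr (_ + _).
rewrite RintegralZr//; last exact: integrable_indic.
by rewrite innerZl /Rintegral integral_indic// setIT.
Qed.

(** Tested against [v], the left side is a scalar integral, to which Cauchy-Schwarz applies
    pointwise. *)
Lemma norm_simple_integral_le S : measurable_simple S ->
  `|simple_integral mu S| <= \int[mu]_z `|simple_fun S z|.
Proof.
move=> mS; apply: inner_dual_norm_le; first exact: Rintegral_ge0.
move=> v; have [i1 <-] := integral_inner_simple v mS.
apply: (le_trans (le_normr_Rintegral _ _)) => //.
rewrite -RintegralZr//; last exact: integrable_norm_simple.
apply: le_Rintegral => //.
- exact: (integrable_norm i1).
- under eq_fun do rewrite mulrC.
  exact/integrable_scale/integrable_norm_simple.
- by move=> z _; exact: cauchy_schwarz.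
Qed.

(** The sets of a simple function may overlap, so concatenation is addition. *)
Definition simple_sub S S' : simple T W := S ++ [seq (p.1, - p.2) | p <- S'].

Lemma measurable_simple_sub S S' : measurable_simple S -> measurable_simple S' ->
  measurable_simple (simple_sub S S').
Proof.
move=> mS mS' p; rewrite mem_cat => /orP[/mS//|/mapP[q qS' ->]].
exact: (mS' _ qS').
Qed.

Lemma simple_fun_sub S S' z :
  simple_fun (simple_sub S S') z = simple_fun S z - simple_fun S' z.
Proof.
rewrite /simple_fun big_cat/= big_map -sumrN; congr (_ + _).
by apply: eq_bigr => p _; rewrite scalerN.
Qed.

Lemma simple_integral_sub S S' : simple_integral mu (simple_sub S S') =
  simple_integral mu S - simple_integral mu S'.
Proof.
rewrite /simple_integral big_cat/= big_map -sumrN; congr (_ + _).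
by apply: eq_bigr => p _; rewrite scalerN.
Qed.

Definition simple_restr S (A : set T) : simple T W :=
  [seq (p.1 `&` A, p.2) | p <- S].

Lemma measurable_simple_restr S (A : set T) :
  measurable A -> measurable_simple S -> measurable_simple (simple_restr S A).
Proof.
move=> mA mS _ /mapP[p pS ->].
by apply: measurableI => //; exact: (mS _ pS).
Qed.

Lemma simple_fun_restr S (A : set T) z :
  simple_fun (simple_restr S A) z = (\1_A z : R) *: simple_fun S z.
Proof.
rewrite /simple_fun big_map scaler_sumr; apply: eq_bigr => p _ /=.
by rewrite indicI scalerA mulrC.
Qed.

Import HBSimple.
(** The pointwise product of [h] and [S], refined along the finitely many level sets of [h]. *)
Definition simple_scale (h : {sfun T >-> R}) S : simple T W :=
  [seq (h @^-1` [set y] `&` p.1, y *: p.2)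
    | y <- finmap.enum_fset (fset_set (range h)), p <- S].

Lemma measurable_simple_scale (h : {sfun T >-> R}) S :
  measurable_simple S -> measurable_simple (simple_scale h S).
Proof.
move=> mS p /allpairsP[[y q] /= [_ qS ->]] /=.
by apply: measurableI; [exact: measurable_sfunP|exact: (mS _ qS)].
Qed.

Lemma simple_fun_scale (h : {sfun T >-> R}) S z :
  simple_fun (simple_scale h S) z = h z *: simple_fun S z.
Proof.
rewrite /simple_fun big_allpairs_dep/= fimfunE fsbig_finite//= scaler_suml.
apply: eq_bigr => y _; rewrite scaler_sumr; apply: eq_bigr => p _.
by rewrite indicI !scalerA; congr (_ *: _); rewrite mulrC mulrA.
Qed.

End simple_functions.

(** * Existence of Bochner integrals and their pairing with vectors *)

Section bochner_theory.
Context d (T : measurableType d) (R : realType) (W : hilbertType R).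
Variable mu : {finite_measure set T -> \bar R}.
Implicit Types (f : T -> W) (v w : W).

Lemma bochnerP f : bochner_integrable mu f ->
  is_bochner_integral mu f (bochner mu f).
Proof. by move=> [w fw]; exact: (xgetPex 0 (ex_intro _ w fw)). Qed.

(** Both sides are close to the pairing of one simple integral with [v]. The integrable [e] stands
    in for [inner (f z) v], whose measurability is not assumed. *)
Lemma is_bochner_integral_inner f w v (e : T -> R) :
  is_bochner_integral mu f w -> mu.-integrable setT (EFin \o e) ->
  {ae mu, forall z, e z = inner (f z) v} ->
  inner w v = \int[mu]_z e z.
Proof.
move=> [S [mS _ Sf Sw]] ie ef; apply/eqP.
rewrite -subr_eq0 -normr_le0; apply/ler_addgt0Pl => del del0; rewrite addr0.
(* The added 1 keeps the divisor positive when [v] is 0; each of the two errors below then costs at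
   most [del / 2]. *)
pose c := `|v| + 1; have c0 : 0 < c by rewrite ltr_wpDl.
have e0 : 0 < del / c / 2 by rewrite !divr_gt0.
have [n [Sn In]] : exists n,
    (\int[mu]_z (`|simple_fun (S n) z - f z|)%:E <= (del / c / 2)%:E)%E /\
    `|w - simple_integral mu (S n)| <= del / c / 2.
  near \oo => n; exists n; split.
    apply/ltW; near: n; move/fine_cvgP: Sf => [fS /cvgrPdist_lt/(_ _ e0) Sf].
    near=> n; have Sfn : `|0 - fine (\int[mu]_z
      (`|simple_fun (S n) z - f z|)%:E)%E| < del / c / 2 by near: n.
    rewrite -[ltLHS]fineK ?lte_fin; last by near: n.
    by rewrite (le_lt_trans _ Sfn)// sub0r normrN ler_norm.
  by near: n; move/cvgrPdist_le: Sw => /(_ _ e0).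
have [iS eS] := integral_inner_simple mu v (mS n).
have h : `|inner (simple_integral mu (S n)) v - \int[mu]_z e z|
         <= c * (del / c / 2).
  rewrite -eS -RintegralB//.
  have iB := integrable_sub iS ie.
  apply: (le_trans (le_normr_Rintegral measurableT iB)).
  rewrite -ler_pdivrMl// -RintegralZl//; last exact: (integrable_norm iB).
  rewrite -lee_fin /Rintegral fineK; last first.
    apply: integrable_fin_num => //.
    exact/integrable_scale/(integrable_norm iB).
  (* The norm of [simple_fun (S n) z - f z] is not known to be measurable, so lower integrals are
     compared. *)
  apply: le_trans Sn; apply: ae_ge0_le_lower_integral => //.
    by move=> z; rewrite lee_fin mulr_ge0 ?invr_ge0// ltW.
  apply: filterS ef => z ->; rewrite lee_fin -innerBl.
  rewrite ler_pdivrMl// mulrC (le_trans (cauchy_schwarz _ _))//.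
  by rewrite ler_wpM2l// lerDl.
have -> : inner w v - \int[mu]_z e z =
    inner (w - simple_integral mu (S n)) v +
    (inner (simple_integral mu (S n)) v - \int[mu]_z e z).
  by rewrite innerBl; ring.
apply: (le_trans (ler_normD _ _)).
have -> : del = c * (del / c / 2) + c * (del / c / 2).
  by field; rewrite gt_eqF.
apply: lerD => //; apply: (le_trans (cauchy_schwarz _ _)); rewrite mulrC.
by apply: ler_pM => //; rewrite lerDl.
Unshelve. all: by end_near. Qed.

(** Strong (Bochner) measurability up to a null set. *)
Definition ae_simple_limit f := exists S : nat -> simple T W,
  (forall n, measurable_simple (S n)) /\
  {ae mu, forall z, simple_fun (S n) z @[n --> \oo] --> f z}.

Import HBSimple.
Lemma ae_simple_limit_scale (h : T -> R) f : measurable_fun setT h ->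
  ae_simple_limit f -> ae_simple_limit (fun z => h z *: f z).
Proof.
move=> /measurable_EFinP mh [S [mS Sf]].
have [g gh] := approximation_sfun measurableT mh.
exists (fun n => simple_scale (g n) (S n)); split.
  by move=> n; exact: measurable_simple_scale.
apply: filterS Sf => z Sz; under eq_fun do rewrite simple_fun_scale.
by apply: cvgZ => //; have /fine_cvgP[_] := gh z I.
Qed.

Lemma norm_sub_le_triangle (x y z : W) : `|x - y| <= `|x - z| + `|y - z|.
Proof. by rewrite (distrC y) (le_trans _ (ler_normD _ _))// addrA subrK. Qed.

(* The simple approximations are cut off where they exceed [g + 1], so that
   dominated convergence upgrades almost everywhere convergence to L^1. *)
Lemma dominated_bochner_integrable f (g : T -> R) : ae_simple_limit f ->
  mu.-integrable setT (EFin \o g) -> {ae mu, forall z, `|f z| <= g z} ->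
  bochner_integrable mu f.
Proof.
move=> [S [mS Sf]] ig fg.
have mg := integrable_measurable ig.
have [N [mN muN sN]] : {ae mu, forall z,
    simple_fun (S n) z @[n --> \oo] --> f z /\ `|f z| <= g z}.
  by apply: filterS2 Sf fg.
have offN z : ~ N z ->
    simple_fun (S n) z @[n --> \oo] --> f z /\ `|f z| <= g z.
  by move=> Nz; apply: contrapT => /sN.
pose A n := ~` N `&` [set z | `|simple_fun (S n) z| <= g z + 1].
have mA n : measurable (A n).
  apply: measurableI; first exact: measurableC.
  rewrite -[X in measurable X]setTI; apply: measurable_fun_le => //.
    exact: measurable_norm_simple.
  exact: measurable_funD.
pose S' n := simple_restr (S n) (A n).
have mS' n : measurable_simple (S' n) by exact: measurable_simple_restr.
(* Setting [f] to 0 on the exceptional set makes the truncated approximations converge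
   everywhere. *)
pose f' z : W := (\1_(~` N) z : R) *: f z.
have S'f z : simple_fun (S' n) z @[n --> \oo] --> f' z.
  under eq_fun do rewrite simple_fun_restr.
  rewrite /f'; have [Nz|Nz] := pselect (N z).
    rewrite indicE memNset ?scale0r; last by move=> /(_ Nz).
    rewrite (_ : (fun n => _) = cst 0); first exact: cvg_cst.
    by apply/funext => n; rewrite indicE memNset ?scale0r// => -[/(_ Nz)].
  have [Sz fz] := offN z Nz.
  rewrite indicE mem_set ?scale1r//.
  (* Off [N] the cutoff is eventually inactive: the approximation comes within 1 of [f z], whose
     norm is at most [g z]. *)
  apply: (cvg_trans _ Sz); apply: near_eq_cvg.
  move/cvgrPdist_le : (Sz) => /(_ _ ltr01) Sz1.
  near=> n; rewrite indicE mem_set ?scale1r//; split => //=.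
  have Szn : `|f z - simple_fun (S n) z| <= 1 by near: n.
  rewrite -[simple_fun _ _](subrK (f z)) (le_trans (ler_normD _ _))//.
  by rewrite addrC lerD// distrC.
pose h n z := `|simple_fun (S' n) z - f' z|.
(* [h n] is the pointwise limit in [m] of the norms of the simple functions [S' n - S' m]. *)
have mh n : measurable_fun setT (h n).
  apply: (@measurable_fun_cvg _ _ _ _
    (fun m z => `|simple_fun (simple_sub (S' n) (S' m)) z|)).
    by move=> m; exact/measurable_norm_simple/measurable_simple_sub.
  move=> z _; under eq_fun do rewrite simple_fun_sub.
  by apply: cvg_norm; apply: cvgB; [exact: cvg_cst|exact: S'f].
have hb n z : h n z <= 2 * `|g z| + 1.
  rewrite /h simple_fun_restr /f' !indicE.
  have [Nz|Nz] := pselect (N z).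
    rewrite memNset; last by move=> [/(_ Nz)].
    rewrite memNset; last by move=> /(_ Nz).
    by rewrite !scale0r subrr normr0 addr_ge0// mulr_ge0.
  have [_ fz] := offN z Nz.
  rewrite [X in _ - X *: _](_ : _ = 1) ?scale1r; last by rewrite mem_set.
  have g0 : 0 <= g z by exact: le_trans fz.
  rewrite (ger0_norm g0) (le_trans (ler_normB _ _))//.
  have [[_ Az]|Az] := pselect (A n z).
    by rewrite mem_set// scale1r; move: Az => /=; lra.
  by rewrite memNset// scale0r normr0; lra.
have ib : mu.-integrable setT (EFin \o (fun z => 2 * `|g z| + 1)).
  apply: integrable_add; last exact: finite_measure_integrable_cst.
  exact/integrable_scale/(integrable_norm ig).
have ih n : mu.-integrable setT (EFin \o h n).
  apply: integrable_le ib _ => // z.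
  by rewrite ger0_norm ?normr_ge0.
have h0 : (\int[mu]_z (h n z)%:E)%E @[n --> \oo] --> 0%E.
  have [||||_ _] := @dominated_convergence _ _ _ mu _ measurableT
    (fun n => EFin \o h n) (cst 0%E) _ _ _ _ ib.
  - by move=> n; exact/measurable_EFinP.
  - exact: measurable_cst.
  - apply: aeW => z _ /=; apply: cvg_EFin; first exact: nearW.
    rewrite /h -(normr0 W) -(subrr (f' z)).
    by apply: cvg_norm; apply: cvgB; [exact: S'f|exact: cvg_cst].
  - by apply: aeW => z n _ /=; rewrite lee_fin ger0_norm ?normr_ge0.
  by rewrite integral0.
have f'f : {ae mu, forall z, f' z = f z}.
  exists N; split => // z /=; apply: contra_notP => Nz.
  by rewrite /f' indicE mem_set// scale1r.
have eh n : (\int[mu]_z (h n z)%:E =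
             \int[mu]_z (`|simple_fun (S' n) z - f z|)%:E)%E.
  by apply/eqP; rewrite eq_le; apply/andP; split;
    apply: ae_ge0_le_lower_integral => [z|z|]; rewrite ?lee_fin ?normr_ge0//;
    apply: filterS f'f => z; rewrite /h => ->.
(* By the triangle inequality through [f'], two simple integrals differ by at most the sum of the
   integrals of [h n] and [h m]; completeness of [W] then gives the limit. *)
have : cvg (simple_integral mu (S' n) @[n --> \oo]).
  apply/cauchy_cvgP/cauchy_ballP => e e0.
  have e20 : 0 < e / 2 by rewrite divr_gt0.
  move/fine_cvgP: (h0) => [_ /cvgrPdist_lt/(_ _ e20) h0e].
  rewrite near_map2; near=> n m; rewrite -ball_normE/= -simple_integral_sub.
  rewrite (le_lt_trans (norm_simple_integral_le _ (measurable_simple_sub _ _)))//.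
  have -> : e = e / 2 + e / 2 by lra.
  have hn : `|0 - fine (\int[mu]_z (h n z)%:E)%E| < e / 2 by near: n.
  have hm : `|0 - fine (\int[mu]_z (h m z)%:E)%E| < e / 2 by near: m.
  apply: (@le_lt_trans _ _ (\int[mu]_z (h n z + h m z))).
    apply: le_Rintegral => //.
    - exact/integrable_norm_simple/measurable_simple_sub.
    - exact: integrable_add.
    - by move=> z _; rewrite simple_fun_sub norm_sub_le_triangle.
  rewrite RintegralD//; apply: ltrD.
    by rewrite (le_lt_trans _ hn)// sub0r normrN ler_norm.
  by rewrite (le_lt_trans _ hm)// sub0r normrN ler_norm.
move=> /cvg_ex[w Iw]; exists w, S'; split => //.
  by apply: filterS f'f => z <-.
by under eq_fun do rewrite -eh.
Unshelve. all: by end_near. Qed.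

Variables (kappa : T -> W) (b : R).
Hypothesis kappa_lim : ae_simple_limit kappa.
Hypothesis kappa_le : forall z, `|kappa z| <= b.

(** The dominating function is [b * |h|]. The map [kappa] will be the kernel section map on [X], or
    its composition with the coarsening. *)
Lemma is_bochner_integral_scale (h : T -> R) :
  mu.-integrable setT (EFin \o h) ->
  is_bochner_integral mu (fun z => h z *: kappa z)
                         (bochner mu (fun z => h z *: kappa z)).
Proof.
move=> ih; apply: bochnerP.
apply: (@dominated_bochner_integrable _ (fun z => b * `|h z|)).
- exact/ae_simple_limit_scale/kappa_lim/integrable_measurable/ih.
- exact/integrable_scale/(integrable_norm ih).
- by apply: aeW => z; rewrite normrZ mulrC ler_wpM2r.
Qed.

Lemma inner_bochner_scale (h e : T -> R) v :
  mu.-integrable setT (EFin \o h) -> measurable_fun setT e ->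
  (forall z, `|e z| <= b * `|v|) ->
  {ae mu, forall z, e z = inner (kappa z) v} ->
  inner (bochner mu (fun z => h z *: kappa z)) v = \int[mu]_z (h z * e z).
Proof.
move=> ih me eb ek.
apply: (is_bochner_integral_inner (is_bochner_integral_scale ih)).
  by under eq_fun do rewrite mulrC; exact: integrable_bounded_mul eb ih.
by apply: filterS ek => z ->; rewrite innerZl.
Qed.

End bochner_theory.

(** * Square-integrable functions and their norm *)

Section L2_functions.
Context d (T : measurableType d) (R : realType) (mu : {measure set T -> \bar R}).
Implicit Types f g : T -> R.

Lemma L2norm_sqr f : (\int[mu]_z (f z ^+ 2)%:E = L2norm mu f `^ 2)%E.
Proof.
rewrite /L2norm poweR_Lnorm ?pnatr_eq0//; apply: eq_integral => z _ /=.
by rewrite powR_mulrn// real_normK// num_real.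
Qed.

Lemma L2norm_le f (c : R) : 0 <= c -> (L2norm mu f <= c%:E)%E ->
  (\int[mu]_z (f z ^+ 2)%:E <= (c ^+ 2)%:E)%E.
Proof.
move=> c0 fc; rewrite L2norm_sqr.
apply: (@le_trans _ _ (c%:E `^ 2)%E); last by rewrite /= powR_mulrn.
apply: gt0_ler_poweR => //; rewrite in_itv/= ?leey ?andbT//.
exact: Lnorm_ge0.
Qed.

Lemma LfunP2 f : f \in Lfun mu 2%:E <->
  measurable_fun setT f /\ mu.-integrable setT (EFin \o (fun z => f z ^+ 2)).
Proof.
split=> [fL|[mf /integrableP[_ fi]]].
  split; last exact: Lfun2_integrable_sqr.
  by move: fL; rewrite inE => /andP[]; rewrite inE.
apply/andP; split; rewrite inE//= /finite_norm.
apply: (@lty_poweRy _ _ 2); rewrite ?pnatr_eq0// -/(L2norm mu f) -L2norm_sqr.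
apply: le_lt_trans fi; rewrite le_eqVlt; apply/orP; left; apply/eqP.
by apply: eq_integral => z _ /=; rewrite ger0_norm// sqr_ge0.
Qed.

End L2_functions.

(** * Densities and change of measure *)

Section radon_nikodym.
Context d (T : measurableType d) (R : realType).
Variables (nu : {finite_measure set T -> \bar R})
          (mu : {sigma_finite_measure set T -> \bar R}).
Hypothesis numu : nu `<< mu.

(** A version of the density that, under domination, is nonnegative at every point rather than
    almost everywhere. *)
Definition rn_density (z : T) : R := fine (Radon_Nikodym_SigmaFinite.f nu mu z).

Lemma rn_densityE z :
  (rn_density z)%:E = Radon_Nikodym_SigmaFinite.f nu mu z.
Proof. by rewrite fineK// Radon_Nikodym_SigmaFinite.f_fin_num. Qed.

Lemma rn_density_ge0 z : 0 <= rn_density z.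
Proof. exact/fine_ge0/Radon_Nikodym_SigmaFinite.f_ge0. Qed.

Lemma measurable_rn_density : measurable_fun setT rn_density.
Proof.
apply: (@integrable_measurable _ _ _ mu).
rewrite (_ : _ \o _ = Radon_Nikodym_SigmaFinite.f nu mu).
  exact: Radon_Nikodym_SigmaFinite.f_integrable.
by apply/funext => z /=; rewrite rn_densityE.
Qed.

Lemma ae_rn_density : {ae mu, forall z,
  fine (Radon_Nikodym (charge_of_finite_measure nu) mu z) = rn_density z}.
Proof.
have := ae_eq_Radon_Nikodym_SigmaFinite numu measurableT.
by apply: filterS => z /(_ I); rewrite /rn_density => ->.
Qed.

Lemma ge0_integral_rn_density (g : T -> R) : measurable_fun setT g ->
  (forall z, 0 <= g z) ->
  (\int[nu]_z (g z)%:E = \int[mu]_z (g z * rn_density z)%:E)%E.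
Proof.
move=> mg g0.
rewrite -(Radon_Nikodym_SigmaFinite.change_of_variables numu)//.
- by apply: eq_integral => z _; rewrite EFinM rn_densityE.
- exact/measurable_EFinP.
Qed.

Lemma integrable_rn_density (g : T -> R) : nu.-integrable setT (EFin \o g) ->
  mu.-integrable setT (EFin \o (fun z => g z * rn_density z)).
Proof.
move=> ig; have mg := integrable_measurable ig.
apply/integrableP; split.
  by apply/measurable_EFinP/measurable_funM => //; exact: measurable_rn_density.
move/integrableP: ig => [_]; rewrite (ge0_integral_rn_density
  (g := fun z => `|g z|))//; last exact: measurableT_comp.
by under [X in _ -> (X < _)%E]eq_integral => z _ do
  rewrite /= normrM (ger0_norm (rn_density_ge0 z)).
Qed.

Lemma Rintegral_rn_density (g : T -> R) : nu.-integrable setT (EFin \o g) ->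
  \int[nu]_z g z = \int[mu]_z (g z * rn_density z).
Proof.
move=> ig; rewrite /Rintegral -(Radon_Nikodym_change_of_variables numu)//.
congr fine; apply: ae_eq_integral => //.
- apply: emeasurable_funM; first exact: measurable_int ig.
  exact/measurable_int/Radon_Nikodym_integrable.
- exact: measurable_int (integrable_rn_density ig).
apply: filterS ae_rn_density => z eqz _; rewrite EFinM -eqz fineK//.
exact: Radon_Nikodym_fin_num.
Qed.

End radon_nikodym.

(** * Quadratic mean differentiability *)

(** Here [a] and [b] are square roots of densities and [y] is half of [eps * s * b]. The weight
    [tau] in the AM-GM inequality puts a small factor on [a ^+ 2 + b ^+ 2], whose integral is 2, and
    the large factor on the squared remainder, which is of smaller order. *)
Lemma qmd_remainder_le (R : realType) (a b y tau : R) : 0 < tau ->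
  `|a ^+ 2 - b ^+ 2 - 2 * y * b| <=
  (a - b - y) ^+ 2 * ((2 * tau)^-1 + 2^-1) + tau * (a ^+ 2 + b ^+ 2)
  + 3 / 2 * y ^+ 2.
Proof.
move=> tau0; set r := a - b - y.
have -> : a ^+ 2 - b ^+ 2 - 2 * y * b = r * (a + b) + (y * r + y ^+ 2).
  by rewrite /r; ring.
have h1 : `|r * (a + b)| <= r ^+ 2 * (2 * tau)^-1 + tau * (a ^+ 2 + b ^+ 2).
  have h x y' : x * y' <= x ^+ 2 * (2 * tau)^-1 + tau / 2 * y' ^+ 2.
    have : 0 <= (x - tau * y') ^+ 2 * (2 * tau)^-1.
      by rewrite mulr_ge0 ?sqr_ge0// invr_ge0 mulr_ge0// ltW.
    suff -> : (x - tau * y') ^+ 2 * (2 * tau)^-1 =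
      x ^+ 2 * (2 * tau)^-1 + tau / 2 * y' ^+ 2 - x * y' by rewrite subr_ge0.
    by field; rewrite gt_eqF.
  have hab : tau / 2 * (a + b) ^+ 2 <= tau * (a ^+ 2 + b ^+ 2).
    have : 0 <= tau * (a - b) ^+ 2 by rewrite mulr_ge0 ?sqr_ge0// ltW.
    by rewrite -subr_ge0 => h2; rewrite -subr_ge0; lra.
  rewrite ler_norml; apply/andP; split.
    have := h (- r) (a + b); rewrite sqrrN mulNr; lra.
  have := h r (a + b); lra.
have h2 : `|y * r + y ^+ 2| <= r ^+ 2 / 2 + 3 / 2 * y ^+ 2.
  have p1 := sqr_ge0 (y - r); have p2 := sqr_ge0 (y + r).
  have p3 := sqr_ge0 y.
  by rewrite ler_norml; apply/andP; split; nra.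
by rewrite (le_trans (ler_normD _ _))//; lra.
Qed.

Lemma Rintegral_prob_cst d (T : measurableType d) (R : realType)
    (P : probability T R) (c : R) : \int[P]_z (cst c z) = c.
Proof.
rewrite Rintegral_cst// -[RHS]mulr1; congr (_ * _).
exact: (congr1 fine (probability_setT P)).
Qed.

Section quadratic_mean_differentiability.
Context d (Z : measurableType d) (R : realType).
Implicit Types (M : set (probability Z R)) (P : probability Z R) (s : Z -> R).

(** The threshold on [eps] is chosen before [g] and [c], so the test function may itself vary with
    [eps] and with the vector paired against. *)
Lemma qmd_expansion M P s Pe : s \in Lfun P 2%:E -> qmd_submodels M P s Pe ->
  forall e : R, 0 < e -> \forall eps \near 0^'+, forall (g : Z -> R) (c : R),
    measurable_fun setT g -> (forall z, `|g z| <= c) ->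
    `|\int[Pe eps]_z g z - \int[P]_z (g z * (1 + eps * s z))| <= c * (e * eps).
Proof.
move=> sL [_ Pe0 [mu [Pmu Dmu]]] e e0.
have [ms is2] := (LfunP2 _ _).1 sL.
have is1 : P.-integrable setT (EFin \o s).
  by apply/Lfun1_integrable/(Lfun_subset12 _ sL); exact: fin_num_measure.
set A := \int[P]_z (s z ^+ 2).
have A0 : 0 <= A by apply: Rintegral_ge0 => z _; exact: sqr_ge0.
(* The final bound is a sum of terms worth at most [4 * eta * eps]; [eta <= 1] is used to absorb
   [tau * tau] into [tau]. *)
pose eta := Num.min 1 (e / 4).
have eta0 : 0 < eta by rewrite lt_min ltr01 divr_gt0.
have eta1 : eta <= 1 by rewrite ge_min lexx.
have etae : 4 * eta <= e.
  by rewrite mulrC -ler_pdivlMr// ge_min lexx orbT.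
have P0mu : P `<< mu by rewrite -Pe0; apply: Pmu; rewrite lexx ler01.
near=> eps => g c mg gc.
have eps0 : 0 < eps by near: eps; exact: nbhs_right_gt.
have eps1 : eps <= 1 by near: eps; exact: nbhs_right_le.
(* This makes [eps * A <= eta], so that the second-order term in [s ^+ 2] is at most [tau]. *)
have epsA : eps <= eta / (A + 1).
  by near: eps; apply: nbhs_right_le; rewrite divr_gt0// ltr_wpDl.
have Pemu : Pe eps `<< mu by apply: Pmu; rewrite eps1 ltW.
pose fe : Z -> R := rn_density (Pe eps) mu.
pose f0 : Z -> R := rn_density P mu.
pose r z : R :=
  Num.sqrt (fe z) - Num.sqrt (f0 z) - eps / 2 * s z * Num.sqrt (f0 z).
have mfe : measurable_fun setT fe by exact: measurable_rn_density.
have mf0 : measurable_fun setT f0 by exact: measurable_rn_density.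
have mr : measurable_fun setT r.
  have ma (h : Z -> R) : measurable_fun setT h ->
      measurable_fun setT (fun z : Z => Num.sqrt (h z)).
    by move=> mh; apply: measurableT_comp mh; exact: measurable_sqrt.
  apply: measurable_funB; first by apply: measurable_funB; exact: ma.
  by apply: measurable_funM; [exact: measurable_funM|exact: ma].
(* Differentiability is applied with tolerance [eta ^+ 2], then carried over to the chosen versions
   of the densities, which agree with the given ones almost everywhere. *)
have r2 : (\int[mu]_z (r z ^+ 2)%:E <= (eta ^+ 2 * eps ^+ 2)%:E)%E.
  have : (\int[mu]_z
      ((Num.sqrt (density (Pe eps) mu z) - Num.sqrt (density P mu z)
      - eps / 2 * s z * Num.sqrt (density P mu z)) ^+ 2)%R%:E <=
      (eta ^+ 2 * eps ^+ 2)%:E)%E.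
    by near: eps; apply: Dmu; exact: exprn_gt0.
  apply: le_trans; apply: ae_ge0_le_lower_integral => [z|z|];
    rewrite ?lee_fin ?sqr_ge0//.
  apply: filterS2 (ae_rn_density Pemu) (ae_rn_density P0mu) => z.
  by rewrite /density => -> ->.
have ir2 : mu.-integrable setT (EFin \o (fun z => r z ^+ 2)).
  apply/integrableP; split; first exact/measurable_EFinP/measurable_funX.
  under eq_integral do rewrite /= ger0_norm ?sqr_ge0//.
  by rewrite (le_lt_trans r2)// ltry.
have Ir2 : \int[mu]_z (r z ^+ 2) <= eta ^+ 2 * eps ^+ 2.
  by rewrite -lee_fin /Rintegral fineK//; exact: integrable_fin_num.
have icst (nu : probability Z R) : nu.-integrable setT (EFin \o cst (1 : R)).
  exact: finite_measure_integrable_cst.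
have ife : mu.-integrable setT (EFin \o fe).
  have := integrable_rn_density Pemu (icst _).
  by under eq_fun do rewrite mul1r.
have if0 : mu.-integrable setT (EFin \o f0).
  have := integrable_rn_density P0mu (icst _).
  by under eq_fun do rewrite mul1r.
have Ife : \int[mu]_z fe z = 1.
  have := Rintegral_rn_density Pemu (icst _); rewrite Rintegral_prob_cst => ->.
  by apply: eq_Rintegral => z _; rewrite mul1r.
have If0 : \int[mu]_z f0 z = 1.
  have := Rintegral_rn_density P0mu (icst _); rewrite Rintegral_prob_cst => ->.
  by apply: eq_Rintegral => z _; rewrite mul1r.
have is2f := integrable_rn_density P0mu is2.
have Is2f : \int[mu]_z (s z ^+ 2 * f0 z) = A by rewrite -Rintegral_rn_density.
have ig : (Pe eps).-integrable setT (EFin \o g).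
  have := integrable_bounded_mul mg gc (icst (Pe eps)).
  by under eq_fun do rewrite mulr1.
have ig' : P.-integrable setT (EFin \o (fun z => g z * (1 + eps * s z))).
  apply: (integrable_bounded_mul mg gc).
  by apply: integrable_add; [exact: icst|exact: integrable_scale].
rewrite (Rintegral_rn_density Pemu ig) (Rintegral_rn_density P0mu ig').
have igm := integrable_rn_density Pemu ig.
have igm' := integrable_rn_density P0mu ig'.
rewrite -RintegralB//.
apply: (le_trans (le_normr_Rintegral measurableT (integrable_sub igm igm'))).
have c0 : 0 <= c by rewrite (le_trans _ (gc point)).
(* With the integral of [r ^+ 2] at most [tau ^+ 2], this weight makes both sides of the AM-GM
   inequality of order [tau]. *)
pose tau := eta * eps.
have tau0 : 0 < tau by exact: mulr_gt0.
pose k := (2 * tau)^-1 + 2^-1.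
(* The factor is [3 / 2] times the square of [eps / 2]. *)
pose k' := 3 / 8 * eps ^+ 2.
pose bnd z := k * r z ^+ 2 + (tau * (fe z + f0 z) + k' * (s z ^+ 2 * f0 z)).
have i1 := integrable_scale k ir2.
have i2 := integrable_scale tau (integrable_add ife if0).
have i3 := integrable_scale k' is2f.
have ibnd : mu.-integrable setT (EFin \o bnd).
  by apply: integrable_add => //; exact: integrable_add.
apply: (@le_trans _ _ (\int[mu]_z (c * bnd z))).
  apply: le_Rintegral => //.
  - exact: (integrable_norm (integrable_sub igm igm')).
  - exact: integrable_scale.
  move=> z _; rewrite -mulrA -mulrBr normrM; apply: ler_pM => //.
  have fe0 : 0 <= fe z by exact: rn_density_ge0.
  have f00 : 0 <= f0 z by exact: rn_density_ge0.
  have := qmd_remainder_le (Num.sqrt (fe z)) (Num.sqrt (f0 z))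
    (eps / 2 * s z * Num.sqrt (f0 z)) tau0.
  rewrite -/(r z) !exprMn !sqr_sqrtr//.
  have -> : 2 * (eps / 2 * s z * Num.sqrt (f0 z)) * Num.sqrt (f0 z) =
            eps * s z * f0 z.
    by rewrite -{3}(sqr_sqrtr f00); field.
  congr (`|_| <= _); first by rewrite /f0 /fe; ring.
  by rewrite /bnd /k /k'; field; rewrite gt_eqF.
rewrite RintegralZl// ler_wpM2l// RintegralD//; last exact: integrable_add.
rewrite RintegralD// !RintegralZl//; last exact: integrable_add.
rewrite RintegralD// Ife If0 Is2f.
have h1 : k * \int[mu]_z (r z ^+ 2) <= tau.
  apply: (@le_trans _ _ (k * (eta ^+ 2 * eps ^+ 2))).
    by rewrite ler_wpM2l// addr_ge0// invr_ge0 mulr_ge0// ltW.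
  have -> : k * (eta ^+ 2 * eps ^+ 2) = tau / 2 + tau * tau / 2.
    by rewrite /k /tau; field; rewrite !gt_eqF.
  have : tau * tau <= tau * 1.
    by rewrite ler_wpM2l ?(ltW tau0)// mulr_ile1// ltW.
  lra.
have h2 : k' * A <= tau.
  have hA : eps * A <= eta.
    move: epsA; rewrite ler_pdivlMr ?ltr_wpDl// => h.
    by rewrite (le_trans _ h)// ler_wpM2l ?(ltW eps0)// lerDl.
  rewrite /k' /tau.
  have : eps * (eps * A) <= eps * eta by rewrite ler_wpM2l// ltW.
  have : 0 <= eps * (eps * A) by rewrite !mulr_ge0// ltW.
  nra.
apply: (@le_trans _ _ (4 * eta * eps)); last by rewrite ler_wpM2r// ltW.
by move: h1 h2; rewrite /tau; lra.
Unshelve. all: by end_near. Qed.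

End quadratic_mean_differentiability.

(** * Bounded functions and kernel sections *)

Section clamp.
Context (R : realType).
Implicit Types c t : R.

(** Truncation to the interval from [- c] to [c]: it replaces a function bounded almost everywhere
    by one bounded everywhere. *)
Definition clamp c t := Num.max (- c) (Num.min t c).

Lemma clamp_le c t : 0 <= c -> `|clamp c t| <= c.
Proof.
move=> c0; rewrite ler_norml le_max lexx /= ge_max ge_min lexx orbT andbT.
by rewrite (le_trans _ c0)// oppr_le0.
Qed.

Lemma clamp_id c t : `|t| <= c -> clamp c t = t.
Proof. by rewrite ler_norml => /andP[h1 h2]; rewrite /clamp min_l// max_r. Qed.

Lemma measurable_clamp c d (T : measurableType d) (f : T -> R) :
  measurable_fun setT f -> measurable_fun setT (fun z => clamp c (f z)).
Proof.
move=> mf; apply: measurable_maxr; first exact: measurable_cst.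
by apply: measurable_minr => //; exact: measurable_cst.
Qed.

End clamp.

Lemma ae_dominates d (T : measurableType d) (R : realType)
    (mu nu : {measure set T -> \bar R}) (A : T -> Prop) :
  nu `<< mu -> {ae mu, forall z, A z} -> {ae nu, forall z, A z}.
Proof.
move=> /null_content_dominatesP numu [N [mN muN sN]].
by exists N; split => //; exact: numu.
Qed.

Section bounded_functions.
Context d (T : measurableType d) (R : realType) (mu : probability T R).
Implicit Types (f u : T -> R) (m : R).

Lemma ae_bounded_Lfun2 f m : measurable_fun setT f ->
  {ae mu, forall z, `|f z| <= m} -> f \in Lfun mu 2%:E.
Proof.
move=> mf fm; apply/LfunP2; split => //; apply/integrableP; split.
  exact/measurable_EFinP/measurable_funX.
apply: (@le_lt_trans _ _ (\int[mu]_z (cst (m ^+ 2)%:E z))%E).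
  apply: ae_ge0_le_lower_integral => [z|z|]; rewrite ?abse_ge0//.
    by rewrite lee_fin sqr_ge0.
  apply: filterS fm => z fz; rewrite /= lee_fin ger0_norm ?sqr_ge0//.
  by rewrite -(real_normK (num_real (f z))) ler_sqr ?nnegrE// (le_trans _ fz).
exact/integrable_lty/finite_measure_integrable_cst.
Qed.

Lemma Lnorm_infty_le (f : T -> \bar R) (y : \bar R) :
  ('N[mu]_+oo [f] <= y)%E <-> {ae mu, forall z, `|f z| <= y}%E.
Proof.
(* The norm of infinite exponent is an essential supremum only when the total mass is positive. *)
have mu0 : (0 < mu [set: T])%E by rewrite probability_setT.
rewrite unlock; case: ifPn => [_|/negP[]//].
by split=> [/ess_supP//|h]; exact/ess_supP.
Qed.

Lemma Linfty_ballP m u : Linfty_ball mu m u <->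
  measurable_fun setT u /\ {ae mu, forall z, `|u z| <= m}.
Proof.
split=> [[/LfunP2[mu' _] /Lnorm_infty_le h]|[mu' h]].
  by split => //; apply: filterS h => z; rewrite /= lee_fin.
split; first exact: ae_bounded_Lfun2 h.
by apply/Lnorm_infty_le; apply: filterS h => z; rewrite /= lee_fin.
Qed.

End bounded_functions.

(** * Directions of the L^infinity ball inside L^2 *)

Section tangent_space_of_ball.
Context d (T : measurableType d) (R : realType) (rho Q : probability T R).
Hypothesis Qrho : Q `<< rho.
Variables (m : R) (u : T -> R).
Hypotheses (m0 : 0 < m) (Bu : Linfty_ball rho m u).

(* By convexity of the ball the segment from [u] to [v] is a path. *)
Lemma Linfty_ball_direction v : Linfty_ball rho m v ->
  L2_tangent_set Q (Linfty_ball rho m) u (fun x => v x - u x).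
Proof.
move=> /Linfty_ballP[mv vm]; have /Linfty_ballP[mu um] := Bu.
split.
  apply: (@ae_bounded_Lfun2 _ _ _ _ _ (m + m)); first exact: measurable_funB.
  apply: filterS2 (ae_dominates Qrho vm) (ae_dominates Qrho um) => z vz uz.
  by rewrite (le_trans (ler_normB _ _))// lerD.
exists (fun eps x => u x + eps * (v x - u x)); split.
  move=> eps /andP[e0 e1]; apply/Linfty_ballP; split.
    apply: measurable_funD => //; apply: measurable_funM => //.
    exact: measurable_funB.
  apply: filterS2 vm um => z vz uz.
  have -> : u z + eps * (v z - u z) = (1 - eps) * u z + eps * v z by ring.
  rewrite (le_trans (ler_normD _ _))// !normrM (ger0_norm e0).
  rewrite (@ger0_norm _ (1 - eps)) ?subr_ge0//.
  have : (1 - eps) * `|u z| <= (1 - eps) * m by rewrite ler_wpM2l// subr_ge0.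
  have : eps * `|v z| <= eps * m by rewrite ler_wpM2l.
  lra.
move=> e e0; near=> eps.
(* The path is affine in [eps], so its remainder vanishes identically. *)
rewrite [X in L2norm Q X](_ : _ = cst 0); last by apply/funext => x /=; ring.
rewrite /L2norm (_ : _ \o _ = cst 0%E)// Lnorm0 ?eqe ?pnatr_eq0//.
rewrite lee_fin mulr_ge0 ?ltW// expr1.
by near: eps; exact: nbhs_right_gt.
Unshelve. all: by end_near. Qed.

(* [t] is a multiple of [v - 0] for some [v] in the ball, and
   [v - 0 = (v - u) - (0 - u)]. *)
Lemma bounded_in_L2_tangent_space (t : T -> R) (c : R) :
  measurable_fun setT t -> (forall x, `|t x| <= c) ->
  L2_tangent_space Q (Linfty_ball rho m) u t.
Proof.
move=> mt tc; split; first by apply: (ae_bounded_Lfun2 mt (aeW _ tc)).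
move=> e e0.
have c0 : 0 <= c by rewrite (le_trans _ (tc point)).
(* The added 1 keeps the divisor positive when [c] is 0, and [k * t] is still bounded by [m]. *)
pose k := m / (c + 1).
have k0 : 0 < k by rewrite divr_gt0// ltr_wpDl.
pose v x := k * t x.
have Bv : Linfty_ball rho m v.
  apply/Linfty_ballP; split; first exact: measurable_funM.
  apply: aeW => x; rewrite normrM gtr0_norm// /k mulrAC ler_pdivrMr ?ltr_wpDl//.
  by rewrite ler_wpM2l ?(ltW m0)// (le_trans (tc x))// lerDl.
have B0 : Linfty_ball rho m (fun=> 0).
  apply/Linfty_ballP; split; first exact: measurable_cst.
  by apply: aeW => x; rewrite normr0 ltW.
exists 2, (fun i => if i == ord0 then k^-1 else - k^-1),
  (fun i x => (if i == ord0 then v x else 0) - u x); split.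
  move=> i; case: (i == ord0); first exact: (Linfty_ball_direction Bv).
  exact: (Linfty_ball_direction B0).
rewrite [X in L2norm Q X](_ : _ = cst 0).
  by rewrite /L2norm (_ : _ \o _ = cst 0%E)// Lnorm0 ?eqe ?pnatr_eq0.
apply/funext => x /=; rewrite !big_ord_recl big_ord0 /= /v.
by field; rewrite gt_eqF.
Qed.

End tangent_space_of_ball.

(** * Transfer along the coarsening *)

Section pushforwards.
Context d d' (Z : measurableType d) (X : measurableType d') (R : realType).
Variable C : {mfun Z >-> X}.
Implicit Types P : probability Z R.

Lemma distribution_dominates P1 P2 : P1 `<< P2 ->
  distribution P1 C `<< distribution P2 C.
Proof.
move=> /null_content_dominatesP h; apply/null_content_dominatesP => A mA.
by apply: h; rewrite -[X in measurable X]setTI; exact: measurable_funPT.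
Qed.

Lemma ae_distribution P (A : X -> Prop) :
  {ae distribution P C, forall x, A x} -> {ae P, forall z, A (C z)}.
Proof.
move=> [N [mN PN sN]]; exists (C @^-1` N); split => //.
  by rewrite -[X in measurable X]setTI; exact: measurable_funPT.
by move=> z /= /sN.
Qed.

Lemma integrable_distribution P (f : X -> R) : measurable_fun setT f ->
  P.-integrable setT (EFin \o (fun z => f (C z))) ->
  (distribution P C).-integrable setT (EFin \o f).
Proof.
move=> mf /integrableP[_ fi]; apply/integrableP; split.
  exact/measurable_EFinP.
rewrite ge0_integral_distribution//.
by apply/measurable_EFinP; exact: measurableT_comp.
Qed.

Lemma Rintegral_distribution P (f : X -> R) : measurable_fun setT f ->
  P.-integrable setT (EFin \o (fun z => f (C z))) ->
  \int[distribution P C]_x f x = \int[P]_z f (C z).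
Proof.
by move=> mf fi; rewrite /Rintegral integral_distribution//;
  exact/measurable_EFinP.
Qed.

Lemma ae_simple_limit_comp (W : hilbertType R) P (f : X -> W) :
  ae_simple_limit (distribution P C) f -> ae_simple_limit P (f \o C).
Proof.
move=> [S [mS Sf]].
exists (fun n => [seq (C @^-1` p.1, p.2) | p <- S n]); split.
  move=> n _ /mapP[p pS ->] /=.
  rewrite -[X in measurable X]setTI; apply: measurable_funPT => //.
  exact: (mS _ _ pS).
apply: filterS (ae_distribution Sf) => z; apply: cvg_trans.
rewrite (_ : (fun n => simple_fun _ z) = (fun n => simple_fun (S n) (C z)))//.
by apply/funext => n; rewrite /simple_fun big_map.
Qed.

End pushforwards.

(** * Measurability and boundedness of kernel sections *)

Section kernel_sections.
Context d (X : measurableType d) (R : realType) (K : X -> X -> R) (W : rkhs K).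
Implicit Types mu : probability X R.

(** By reproduction the squared norm of the section at [x] is [K x x]. *)
Lemma norm_ksec_le (B : R) : (forall x y, `|K x y| <= B) ->
  forall x, `|ksec W x| <= Num.sqrt B.
Proof.
move=> KB x; rewrite -[leLHS]normr_id -sqrtr_sqr ler_wsqrtr//.
by rewrite -inner_norm inner_ksec ev_ksec (le_trans _ (KB x x))// ler_norm.
Qed.

(** Dividing by the constant extracts strong measurability of the section map from the existence of
    one Bochner integral. *)
Lemma ae_simple_limit_ksec mu m : m != 0 ->
  bochner_integrable mu (fun x => m *: ksec W x) -> ae_simple_limit mu (ksec W).
Proof.
move=> m0 [w [S [mS Sm _ _]]].
have h : ae_simple_limit mu (fun x => m *: ksec W x) by exists S.
have := ae_simple_limit_scale (measurable_cst m^-1) h.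
by under eq_fun do rewrite scalerA mulVf// scale1r.
Qed.

(** [e w] is [ev w] set to 0 on a null set that is the same for all [w]; elsewhere it is a limit of
    inner products of simple functions with [w]. The bound is Cauchy-Schwarz. *)
Lemma measurable_evaluations mu b : ae_simple_limit mu (ksec W) ->
  (forall x, `|ksec W x| <= b) ->
  exists e : W -> X -> R, [/\ forall w, measurable_fun setT (e w),
    forall w x, `|e w x| <= b * `|w| &
    forall w, {ae mu, forall x, e w x = ev w x}].
Proof.
move=> [S [mS [N [mN muN sN]]]] kb.
exists (fun w x => \1_(~` N) x * ev w x); split => w.
- apply: (@measurable_fun_cvg _ _ _ _
    (fun n x => inner (simple_fun (simple_restr (S n) (~` N)) x) w)).
    move=> n; apply: measurable_inner_simple.
    by apply: measurable_simple_restr => //; exact: measurableC.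
  move=> x _; under eq_fun do rewrite simple_fun_restr innerZl.
  have [Nx|Nx] := pselect (N x).
    rewrite indicE memNset; last by move=> /(_ Nx).
    by rewrite mul0r; under eq_fun do rewrite mul0r; exact: cvg_cst.
  apply: cvgM; first exact: cvg_cst.
  have Sx : simple_fun (S n) x @[n --> \oo] --> ksec W x.
    by apply: contrapT => /sN.
  apply/cvgrPdist_le => e e0.
  have e1 : 0 < e / (`|w| + 1) by rewrite divr_gt0// ltr_wpDl.
  move/cvgrPdist_le : Sx => /(_ _ e1); apply: filterS => n Sn.
  rewrite -inner_ksec (innerC w) -innerBl (le_trans (cauchy_schwarz _ _))//.
  move: Sn; rewrite ler_pdivlMr ?ltr_wpDl// => Sn; rewrite (le_trans _ Sn)//.
  by rewrite ler_wpM2l// lerDl.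
- move=> x; rewrite -inner_ksec normrM (le_trans (ler_piMl _ _))//.
    by rewrite indicE; case: (_ \in _); rewrite ?normr1// normr0.
  rewrite (le_trans (cauchy_schwarz _ _))// mulrC ler_wpM2r//.
- exists N; split => // x /=; apply: contra_notP => Nx.
  by rewrite indicE mem_set// mul1r.
Qed.

End kernel_sections.

(** * The total derivative and its adjoint *)

Section L2_estimates.
Context d (T : measurableType d) (R : realType) (mu : probability T R).
Implicit Types f g : T -> R.

Lemma Lfun2_add f g : f \in Lfun mu 2%:E -> g \in Lfun mu 2%:E ->
  (fun z => f z + g z) \in Lfun mu 2%:E.
Proof.
move=> /LfunP2[mf f2] /LfunP2[mg g2]; apply/LfunP2; split.
  exact: measurable_funD.
apply: (integrable_le _ (integrable_scale 2 (integrable_add f2 g2))).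
  by apply: measurable_funX; exact: measurable_funD.
move=> z; rewrite ger0_norm ?sqr_ge0//.
by have := sqr_ge0 (f z - g z); lra.
Qed.

Lemma Lfun2_scale k f : f \in Lfun mu 2%:E -> (fun z => k * f z) \in Lfun mu 2%:E.
Proof.
move=> /LfunP2[mf f2]; apply/LfunP2; split; first exact: measurable_funM.
by under eq_fun do rewrite exprMn; exact: integrable_scale.
Qed.

Lemma Lfun2_sub f g : f \in Lfun mu 2%:E -> g \in Lfun mu 2%:E ->
  (fun z => f z - g z) \in Lfun mu 2%:E.
Proof.
move=> fL gL; under eq_fun do rewrite -mulN1r.
by apply: Lfun2_add => //; exact: Lfun2_scale.
Qed.

Lemma Lfun2_integrable f : f \in Lfun mu 2%:E -> mu.-integrable setT (EFin \o f).
Proof.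
by move=> fL; apply/Lfun1_integrable/(Lfun_subset12 _ fL); exact: fin_num_measure.
Qed.

Lemma Lfun2_integrable_mul f g : f \in Lfun mu 2%:E -> g \in Lfun mu 2%:E ->
  mu.-integrable setT (EFin \o (fun z => f z * g z)).
Proof. by move=> fL gL; exact/Lfun1_integrable/Lfun2_mul_Lfun1. Qed.

(* AM-GM: [2 |f g| <= f^2 / del + del g^2] *)
Lemma Rintegral_norm_mul_le f g del : 0 < del ->
  f \in Lfun mu 2%:E -> g \in Lfun mu 2%:E ->
  (\int[mu]_z (f z ^+ 2)%:E <= (del ^+ 2)%:E)%E ->
  \int[mu]_z `|f z * g z| <= del * (1 + \int[mu]_z (g z ^+ 2)) / 2.
Proof.
move=> del0 fL gL fdel.
have [_ f2] := (LfunP2 _ _).1 fL; have [_ g2] := (LfunP2 _ _).1 gL.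
have i1 := integrable_scale (2 * del)^-1 f2.
have i2 := integrable_scale (del / 2) g2.
apply: (@le_trans _ _ (\int[mu]_z
    ((2 * del)^-1 * f z ^+ 2 + del / 2 * g z ^+ 2))).
  apply: le_Rintegral => //.
  - exact: (integrable_norm (Lfun2_integrable_mul fL gL)).
  - exact: integrable_add.
  move=> z _.
  have h y : f z * y <= (2 * del)^-1 * f z ^+ 2 + del / 2 * y ^+ 2.
    have : 0 <= (f z - del * y) ^+ 2 * (2 * del)^-1.
      by rewrite mulr_ge0 ?sqr_ge0// invr_ge0 mulr_ge0// ltW.
    suff -> : (f z - del * y) ^+ 2 * (2 * del)^-1 =
      (2 * del)^-1 * f z ^+ 2 + del / 2 * y ^+ 2 - f z * y by rewrite subr_ge0.
    by field; rewrite gt_eqF.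
  rewrite ler_norml; apply/andP; split; last exact: h.
  by have := h (- g z); rewrite sqrrN mulrN; lra.
rewrite RintegralD// !RintegralZl//.
have If2 : \int[mu]_z (f z ^+ 2) <= del ^+ 2.
  by rewrite -lee_fin /Rintegral fineK//; exact: integrable_fin_num.
have : (2 * del)^-1 * \int[mu]_z (f z ^+ 2) <= (2 * del)^-1 * del ^+ 2.
  by rewrite ler_wpM2l// invr_ge0 mulr_ge0// ltW.
have -> : (2 * del)^-1 * del ^+ 2 = del / 2 by field; rewrite gt_eqF.
lra.
Qed.

(** The product estimate with second factor 1, where [1 + 1] cancels the division by 2. *)
Lemma Rintegral_norm_le f del : 0 < del -> f \in Lfun mu 2%:E ->
  (\int[mu]_z (f z ^+ 2)%:E <= (del ^+ 2)%:E)%E -> \int[mu]_z `|f z| <= del.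
Proof.
move=> del0 fL fdel.
have -> : \int[mu]_z `|f z| = \int[mu]_z `|f z * cst 1 z|.
  by apply: eq_Rintegral => z _; rewrite mulr1.
apply: (le_trans (Rintegral_norm_mul_le del0 fL (Lfun_cst mu 1 2) fdel)).
have -> : \int[mu]_z (cst 1 z ^+ 2) = 1 :> R.
  rewrite -[RHS](Rintegral_prob_cst mu 1).
  by apply: eq_Rintegral => z _; rewrite expr1n.
lra.
Qed.

Lemma ae_eq_integrable_fin f g : measurable_fun setT f ->
  {ae mu, forall z, f z = g z} -> mu.-integrable setT (EFin \o g) ->
  mu.-integrable setT (EFin \o f).
Proof.
move=> mf fg /integrableP[_ gi]; apply/integrableP; split.
  exact/measurable_EFinP.
apply: le_lt_trans gi; apply: ae_ge0_le_lower_integral => //.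
by apply: filterS fg => z /= ->.
Qed.

Lemma Rintegral_mul_bounded_le f g c : mu.-integrable setT (EFin \o f) ->
  measurable_fun setT g -> (forall z, `|g z| <= c) ->
  `|\int[mu]_z (f z * g z)| <= c * \int[mu]_z `|f z|.
Proof.
move=> fi mg gc.
have ifg : mu.-integrable setT (EFin \o (fun z => f z * g z)).
  by under eq_fun do rewrite mulrC; exact: integrable_bounded_mul gc fi.
apply: (le_trans (le_normr_Rintegral measurableT ifg)).
rewrite -RintegralZl//; last exact: (integrable_norm fi).
apply: le_Rintegral => //; first exact: (integrable_norm ifg).
  exact/integrable_scale/(integrable_norm fi).
by move=> z _; rewrite normrM mulrC ler_wpM2r.
Qed.

End L2_estimates.

(** * Differentiating the kernel embedding and computing the adjoint *)

Section pathwise_differentiability.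
Context (R : realType) (d d' : measure_display)
  (Z : measurableType d) (X : measurableType d') (C : {mfun Z >-> X})
  (M : set (probability Z R)).
Hypothesis M_equivalent :
  forall P1 P2 : probability Z R, M P1 -> M P2 -> P1 `<< P2.
Variables (rho : probability Z R) (K : X -> X -> R) (W : rkhs K).
Hypothesis M_rho : M rho.
Variables (b : R).
Hypothesis ksec_le : forall x, `|ksec W x| <= b.
Hypothesis ksec_lim : ae_simple_limit (distribution rho C) (ksec W).
Variable e : W -> X -> R.
Hypothesis me : forall w, measurable_fun setT (e w).
Hypothesis e_le : forall w x, `|e w x| <= b * `|w|.
Hypothesis eE : forall w, {ae distribution rho C, forall x, e w x = ev w x}.
Variables (m : R) (Q P : probability Z R) (u : X -> R).
Hypotheses (m_gt0 : 0 < m) (M_Q : M Q) (M_P : M P).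
Hypothesis U_u : Linfty_ball (distribution rho C) m u.
Variable c : R.
Hypothesis c_ge1 : 1 <= c.
Let pX := distribution P C.
Let qX := distribution Q C.
Let phi := rn_density pX qX.
Hypothesis phi_le : {ae qX, forall x, phi x <= c}.

Lemma b_ge0 : 0 <= b.
Proof. exact: le_trans (ksec_le point). Qed.

Let pq : pX `<< qX.
Proof. exact/distribution_dominates/M_equivalent. Qed.

Lemma model_ae (P1 : probability Z R) (A : X -> Prop) : M P1 ->
  {ae distribution rho C, forall x, A x} -> {ae P1, forall z, A (C z)}.
Proof.
move=> M1 h; apply: ae_distribution; apply: ae_dominates h.
exact/distribution_dominates/M_equivalent.
Qed.

Lemma model_ae_simple_limit (P1 : probability Z R) : M P1 ->
  ae_simple_limit (distribution P1 C) (ksec W).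
Proof.
move=> M1; have [S [mS Sf]] := ksec_lim; exists S; split => //.
apply: ae_dominates Sf; exact/distribution_dominates/M_equivalent.
Qed.

Lemma inner_kernel_embedding (P1 : probability Z R) (v : X -> R) w : M P1 ->
  Linfty_ball (distribution rho C) m v ->
  inner (kernel_embedding W C P1 v) w = \int[P1]_z (v (C z) * e w (C z)).
Proof.
move=> M1 /Linfty_ballP[mv vm].
have mvC : measurable_fun setT (fun z => v (C z)) by exact: measurableT_comp.
have iv : P1.-integrable setT (EFin \o (fun z => v (C z))).
  apply: Lfun2_integrable; apply: (@ae_bounded_Lfun2 _ _ _ _ _ m) => //.
  exact: (model_ae M1 vm).
rewrite /kernel_embedding (inner_bochner_scale (e := e w)
  (model_ae_simple_limit M1) ksec_le) //.
- rewrite Rintegral_distribution//; first exact: measurable_funM.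
  under eq_fun do rewrite mulrC.
  apply: integrable_bounded_mul iv; last by move=> z; exact: e_le.
  exact: measurableT_comp.
- exact: integrable_distribution.
- apply: (@ae_dominates _ _ _ (distribution rho C)).
    exact/distribution_dominates/M_equivalent.
  by apply: filterS (eE w) => x ->; rewrite innerC inner_ksec.
Qed.

(** The integral passes to the law of [X], then to [qX] with a density at most [c]. Errors measured
    under [qX] are thereby controlled under [P]. *)
Lemma ge0_integral_comp_le (g : X -> R) : measurable_fun setT g ->
  (forall x, 0 <= g x) ->
  (\int[P]_z (g (C z))%:E <= c%:E * \int[qX]_x (g x)%:E)%E.
Proof.
move=> mg g0.
have -> : (\int[P]_z (g (C z))%:E = \int[pX]_x (g x)%:E)%E.
  rewrite ge0_integral_distribution//; first exact/measurable_EFinP.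
rewrite (ge0_integral_rn_density pq)// -ge0_integralZl//; last 3 first.
- exact/measurable_EFinP.
- by move=> x _; rewrite lee_fin.
- by rewrite lee_fin (le_trans _ c_ge1).
apply: ae_ge0_le_lower_integral.
- by move=> x; rewrite lee_fin mulr_ge0// rn_density_ge0.
- by move=> x; rewrite -EFinM lee_fin mulr_ge0// (le_trans _ c_ge1).
by apply: filterS phi_le => x h; rewrite -EFinM lee_fin mulrC ler_wpM2r.
Qed.

(** The density bound gives [c * del ^+ 2]; since [c] is at least 1, replacing [c] by [c ^+ 2] makes
    this a perfect square. *)
Lemma integral_sqr_comp_le (t : X -> R) del : 0 <= del ->
  measurable_fun setT t -> (L2norm qX t <= del%:E)%E ->
  (\int[P]_z (t (C z) ^+ 2)%:E <= ((c * del) ^+ 2)%:E)%E.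
Proof.
move=> del0 mt /(L2norm_le del0) tdel.
have := @ge0_integral_comp_le (fun x => t x ^+ 2).
move=> /(_ (measurable_funX _ mt) (fun=> sqr_ge0 _)) /le_trans; apply.
apply: (@le_trans _ _ (c%:E * (del ^+ 2)%:E)%E).
  by rewrite lee_wpmul2l// lee_fin (le_trans _ c_ge1).
by rewrite -EFinM lee_fin exprMn ler_wpM2r ?sqr_ge0// ler_eXnr.
Qed.

Lemma Lfun2_comp (t : X -> R) : t \in Lfun qX 2%:E ->
  (fun z => t (C z)) \in Lfun P 2%:E.
Proof.
move=> /LfunP2[mt t2]; apply/LfunP2; split; first exact: measurableT_comp.
apply/integrableP; split.
  by apply/measurable_EFinP/measurable_funX; exact: measurableT_comp.
under eq_integral do rewrite /= ger0_norm ?sqr_ge0//.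
have := @ge0_integral_comp_le (fun x => t x ^+ 2).
move=> /(_ (measurable_funX _ mt) (fun=> sqr_ge0 _)) /le_lt_trans; apply.
rewrite lte_mul_pinfty ?lee_fin ?(le_trans _ c_ge1)//.
move/integrableP: t2 => [_].
by under eq_integral do rewrite /= ger0_norm ?sqr_ge0//.
Qed.

Let u_le : {ae distribution rho C, forall x, `|u x| <= m}.
Proof. by have /Linfty_ballP[] := U_u. Qed.

Let measurable_u : measurable_fun setT u.
Proof. by have /Linfty_ballP[] := U_u. Qed.

Let measurable_uC : measurable_fun setT (fun z => u (C z)).
Proof. exact: measurableT_comp. Qed.

Let meC w : measurable_fun setT (fun z => e w (C z)).
Proof. exact: measurableT_comp. Qed.

Lemma uC_Lfun2 : (fun z => u (C z)) \in Lfun P 2%:E.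
Proof. exact: (ae_bounded_Lfun2 measurable_uC (model_ae M_P u_le)). Qed.

Definition combine (s : Z -> R) (t : X -> R) (z : Z) : R :=
  u (C z) * s z + t (C z).

Lemma Lfun2_bounded_mul (g f : Z -> R) k : 0 <= k -> measurable_fun setT g ->
  {ae P, forall z, `|g z| <= k} ->
  f \in Lfun P 2%:E -> (fun z => g z * f z) \in Lfun P 2%:E.
Proof.
move=> k0 mg gk /LfunP2[mf f2]; apply/LfunP2.
split; first exact: measurable_funM.
(* Clamping [g] turns its almost everywhere bound into the pointwise bound that multiplication by a
   bounded function requires. *)
apply: (@ae_eq_integrable_fin _ _ _ _ _ (fun z => clamp k (g z) ^+ 2 * f z ^+ 2)).
- exact/measurable_funX/measurable_funM.
- by apply: filterS gk => z gz; rewrite exprMn clamp_id.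
apply: (@integrable_bounded_mul _ _ _ _ (k ^+ 2)) => //.
  by apply: measurable_funX; exact: measurable_clamp.
by move=> z; rewrite normrX ler_sqr ?nnegrE// clamp_le.
Qed.

Lemma combine_Lfun2 s t : s \in Lfun P 2%:E -> t \in Lfun qX 2%:E ->
  combine s t \in Lfun P 2%:E.
Proof.
move=> sL tL; apply: Lfun2_add; last exact: Lfun2_comp.
exact: (Lfun2_bounded_mul (ltW m_gt0) measurable_uC (model_ae M_P u_le)).
Qed.

Definition derivative (p : (Z -> R) * (X -> R)) : W :=
  bochner P (fun z => combine p.1 p.2 z *: ksec W (C z)).

Lemma is_bochner_integral_derivative s t :
  s \in Lfun P 2%:E -> t \in Lfun qX 2%:E ->
  is_bochner_integral P (fun z => combine s t z *: ksec W (C z))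
    (derivative (s, t)).
Proof.
move=> sL tL; apply: is_bochner_integral_scale.
- exact: (ae_simple_limit_comp (model_ae_simple_limit M_P)).
- by move=> z; exact: ksec_le.
- exact/Lfun2_integrable/combine_Lfun2.
Qed.

Lemma inner_derivative s t w : s \in Lfun P 2%:E -> t \in Lfun qX 2%:E ->
  inner (derivative (s, t)) w = \int[P]_z (combine s t z * e w (C z)).
Proof.
move=> sL tL; apply: (@inner_bochner_scale _ _ _ _ _ (ksec W \o C) b).
- exact: (ae_simple_limit_comp (model_ae_simple_limit M_P)).
- by move=> z; exact: ksec_le.
- exact/Lfun2_integrable/combine_Lfun2.
- exact: meC.
- by move=> z; exact: e_le.
- by apply: filterS (model_ae M_P (eE w)) => z ->; rewrite innerC inner_ksec.
Qed.

(** Evaluation at [y] is the pairing with [ksec W y]; symmetry puts the arguments of [K] in the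
    stated order. *)
Lemma ev_derivative s t y : (forall x y, K x y = K y x) ->
  s \in Lfun P 2%:E -> t \in Lfun qX 2%:E ->
  ev (derivative (s, t)) y = \int[P]_z (K y (C z) * combine s t z).
Proof.
move=> Ksym sL tL; rewrite -inner_ksec inner_derivative//.
apply: ae_eq_lower_Rintegral.
apply: filterS (model_ae M_P (eE (ksec W y))) => z ->.
by rewrite ev_ksec mulrC Ksym.
Qed.

Let mul_e_integrable f w : f \in Lfun P 2%:E ->
  P.-integrable setT (EFin \o (fun z => f z * e w (C z))).
Proof.
move=> fL; under eq_fun do rewrite mulrC.
by apply: (integrable_bounded_mul (meC w) _ (Lfun2_integrable fL)) => z;
  exact: e_le.
Qed.

Lemma derivative_linear a s t s' t' :
  s \in Lfun P 2%:E -> t \in Lfun qX 2%:E ->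
  s' \in Lfun P 2%:E -> t' \in Lfun qX 2%:E ->
  derivative (fun z => a * s z + s' z, fun x => a * t x + t' x) =
  a *: derivative (s, t) + derivative (s', t').
Proof.
move=> sL tL sL' tL'; apply: inner_eq => w.
rewrite innerDl innerZl !inner_derivative//; last 2 first.
- by apply: Lfun2_add => //; exact: Lfun2_scale.
- by apply: Lfun2_add => //; exact: Lfun2_scale.
have i1 := mul_e_integrable w (combine_Lfun2 sL tL).
have i2 := mul_e_integrable w (combine_Lfun2 sL' tL').
rewrite -RintegralZl// -RintegralD//; last exact: integrable_scale.
by apply: eq_Rintegral => z _; rewrite /combine; ring.
Qed.

(** After pairing with [w], the bound on [u] contributes [m * del] through the scores, and the
    passage from [qX] to [P] contributes [c * del] through the directions. *)
Lemma norm_derivative_sub_le s t s' t' (del : R) : 0 < del ->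
  s \in Lfun P 2%:E -> t \in Lfun qX 2%:E ->
  s' \in Lfun P 2%:E -> t' \in Lfun qX 2%:E ->
  (L2norm P (fun z => s z - s' z)%R <= del%:E)%E ->
  (L2norm qX (fun x => t x - t' x)%R <= del%:E)%E ->
  `|derivative (s, t) - derivative (s', t')| <= b * ((m + c) * del).
Proof.
move=> del0 sL tL sL' tL' sdel tdel.
have c0 : 0 < c by exact: lt_le_trans c_ge1.
have dsL := Lfun2_sub sL sL'; have dtL := Lfun2_sub tL tL'.
have dtCL := Lfun2_comp dtL.
have dL := combine_Lfun2 dsL dtL.
apply: inner_dual_norm_le.
  by rewrite mulr_ge0 ?b_ge0// mulr_ge0 ?(ltW del0)// addr_ge0// ltW.
move=> w; rewrite innerBl !inner_derivative//.
rewrite -RintegralB//; [|exact/mul_e_integrable/combine_Lfun2..].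
under eq_Rintegral => z _.
  have -> : combine s t z * e w (C z) - combine s' t' z * e w (C z) =
    combine (fun z => s z - s' z) (fun x => t x - t' x) z * e w (C z).
    by rewrite /combine; ring.
  over.
apply: (le_trans (Rintegral_mul_bounded_le (Lfun2_integrable dL) (meC w)
  (fun z => e_le w (C z)))).
rewrite mulrAC ler_wpM2r// ler_wpM2l ?b_ge0//.
have h1 := Rintegral_norm_le del0 dsL (L2norm_le (ltW del0) sdel).
have h2 : \int[P]_z `|t (C z) - t' (C z)| <= c * del.
  apply: Rintegral_norm_le => //; first exact: mulr_gt0.
  apply: (@integral_sqr_comp_le (fun x => t x - t' x)) => //.
    exact: ltW.
  by have [] := (LfunP2 _ _).1 dtL.
have i1 := integrable_norm (Lfun2_integrable dsL).
have i2 := integrable_norm (Lfun2_integrable dtCL).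
have ub : {ae P, forall z, `|combine (fun z => s z - s' z)
    (fun x => t x - t' x) z| <= m * `|s z - s' z| + `|t (C z) - t' (C z)|}.
  apply: filterS (model_ae M_P u_le) => z uz.
  by rewrite (le_trans (ler_normD _ _))// normrM lerD2r ler_wpM2r.
have im := integrable_scale m i1.
apply: (@le_trans _ _
    (\int[P]_z (m * `|s z - s' z| + `|t (C z) - t' (C z)|))).
  (* The domination [ub] holds only almost everywhere, hence the detour through extended-real
     integrals. *)
  rewrite /Rintegral fine_le//.
  - exact/integrable_fin_num/(integrable_norm (Lfun2_integrable dL)).
  - exact/integrable_fin_num/integrable_add.
  - apply: ae_ge0_le_lower_integral => [z|z|]; rewrite ?lee_fin//.
      by rewrite addr_ge0// mulr_ge0// ltW.
by rewrite RintegralD// RintegralZl// mulrDl lerD// ler_wpM2l ?(ltW m_gt0).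
Qed.

Lemma derivative_expansion s t Pe ue :
  s \in Lfun P 2%:E -> t \in Lfun qX 2%:E -> qmd_submodels M P s Pe ->
  L2_paths qX (Linfty_ball (distribution rho C) m) u t ue ->
  little_o 1 (fun eps => `|kernel_embedding W C (Pe eps) (ue eps) -
    kernel_embedding W C P u - eps *: derivative (s, t)|%:E).
Proof.
move=> sL tL sPe [Uue Due] r r0.
have [MPe _ _] := sPe.
have c0 : 0 < c by exact: lt_le_trans c_ge1.
have b1 : 0 < b + 1 by rewrite ltr_wpDl// b_ge0.
(* The three errors are each at most [b * k * eps] times the norm of the test vector; the added 1
   covers [b = 0]. *)
pose k := r / (3 * (b + 1)).
have k0 : 0 < k by rewrite divr_gt0// mulr_gt0.
have tCL := Lfun2_comp tL.
set A := \int[P]_z (s z ^+ 2).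
set T := \int[P]_z (t (C z) ^+ 2).
have A0 : 0 <= A by apply: Rintegral_ge0 => z _; exact: sqr_ge0.
have T0 : 0 <= T by apply: Rintegral_ge0 => z _; exact: sqr_ge0.
(* With this L^2 bound on [f1], the product estimate bounds the integral of [|f1 * s|] by
   [k / 2]. *)
pose del := k / (1 + A).
have del0 : 0 < del by rewrite divr_gt0// ltr_wpDr.
(* The integral of [f1 ^+ 2] will be at most [eps ^+ 2 * (2 * (k ^+ 2 + T))], hence at most
   [eps * B]; the added 1 makes [B] positive. *)
pose B := 2 * (k ^+ 2 + T) + 1.
have B0 : 0 < B by rewrite ltr_wpDl// mulr_ge0// addr_ge0// sqr_ge0.
near=> eps.
have eps0 : 0 < eps by near: eps; exact: nbhs_right_gt.
have eps1 : eps <= 1 by near: eps; exact: nbhs_right_le.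
have epsB : eps <= del ^+ 2 / B.
  by near: eps; apply: nbhs_right_le; rewrite divr_gt0// exprn_gt0.
(* The tolerance [k / m] offsets the factor [m] in the bound on the test function; likewise [k / c]
   below offsets the density bound. *)
have qmd : forall (g : Z -> R) (l : R),
    measurable_fun setT g -> (forall z, `|g z| <= l) ->
    `|\int[Pe eps]_z g z - \int[P]_z (g z * (1 + eps * s z))|
      <= l * (k / m * eps).
  by near: eps; apply: (qmd_expansion sL sPe); exact: divr_gt0.
have path : (L2norm qX (fun x => ue eps x - u x - eps * t x)%R <=
    (k / c * eps)%:E)%E.
  by near: eps; apply: Due; exact: divr_gt0.
have epsI : 0 <= eps <= 1 by rewrite eps1 ltW.
have M1 := MPe _ epsI; have Uv := Uue _ epsI.
set v := ue eps in path Uv *; set P1 := Pe eps in qmd M1 *.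
have [mv vm] := (Linfty_ballP _ _ _).1 Uv.
have mvC : measurable_fun setT (fun z => v (C z)) by exact: measurableT_comp.
have vCm : {ae P, forall z, `|v (C z)| <= m} by exact: (model_ae M_P vm).
have vCL : (fun z => v (C z)) \in Lfun P 2%:E by exact: (ae_bounded_Lfun2 mvC vCm).
pose f1 z := v (C z) - u (C z).
pose f0 z := f1 z - eps * t (C z).
have f1L : f1 \in Lfun P 2%:E by exact: Lfun2_sub vCL uC_Lfun2.
have f0L : f0 \in Lfun P 2%:E by apply: Lfun2_sub => //; exact: Lfun2_scale.
have f0_le : (\int[P]_z (f0 z ^+ 2)%:E <= ((k * eps) ^+ 2)%:E)%E.
  have -> : k * eps = c * (k / c * eps) by field; rewrite gt_eqF.
  apply: (@integral_sqr_comp_le (fun x => v x - u x - eps * t x)) => //.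
    exact: (mulr_ge0 (divr_ge0 (ltW k0) (ltW c0)) (ltW eps0)).
  apply: measurable_funB; first exact: measurable_funB.
  by apply: measurable_funM => //; have [] := (LfunP2 _ _).1 tL.
have If0 : \int[P]_z `|f0 z| <= k * eps.
  by apply: Rintegral_norm_le => //; exact: mulr_gt0.
have [_ f0i] := (LfunP2 _ _).1 f0L.
have [_ f1i] := (LfunP2 _ _).1 f1L.
have [_ ti] := (LfunP2 _ _).1 tCL.
have f1_le : (\int[P]_z (f1 z ^+ 2)%:E <= (del ^+ 2)%:E)%E.
  have -> : (\int[P]_z (f1 z ^+ 2)%:E = (\int[P]_z (f1 z ^+ 2))%:E)%E.
    by rewrite /Rintegral fineK//; exact: integrable_fin_num f1i.
  rewrite lee_fin.
  have I0 : \int[P]_z (f0 z ^+ 2) <= (k * eps) ^+ 2.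
    by rewrite -lee_fin /Rintegral fineK//; exact: integrable_fin_num f0i.
  have i0 := integrable_scale 2 f0i.
  have it := integrable_scale (2 * eps ^+ 2) ti.
  (* Since [f1] is [f0] plus [eps * t], its square is at most twice the sum of the two squares. *)
  apply: (@le_trans _ _ (\int[P]_z
      (2 * f0 z ^+ 2 + 2 * eps ^+ 2 * t (C z) ^+ 2))).
    apply: le_Rintegral => //; first exact: integrable_add.
    move=> z _; rewrite -subr_ge0.
    suff -> : 2 * f0 z ^+ 2 + 2 * eps ^+ 2 * t (C z) ^+ 2 - f1 z ^+ 2 =
      (f1 z - 2 * eps * t (C z)) ^+ 2 by exact: sqr_ge0.
    by rewrite /f0; ring.
  rewrite RintegralD// !RintegralZl// -/T.
  apply: (@le_trans _ _ (eps * (2 * (k ^+ 2 + T)))).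
    have h : eps ^+ 2 * (2 * (k ^+ 2 + T)) <= eps * (2 * (k ^+ 2 + T)).
      rewrite ler_wpM2r ?mulr_ge0// ?addr_ge0 ?sqr_ge0//.
      by rewrite expr2 ler_piMr// ltW.
    by apply: le_trans h; rewrite exprMn in I0; lra.
  move: epsB; rewrite ler_pdivlMr// => epsB; apply: le_trans epsB.
  by rewrite ler_wpM2l ?(ltW eps0)// lerDl.
have If1 : \int[P]_z `|f1 z * s z| <= k.
  apply: (le_trans (Rintegral_norm_mul_le del0 f1L sL f1_le)); rewrite -/A /del.
  have -> : k / (1 + A) * (1 + A) / 2 = k / 2.
    by field; rewrite gt_eqF// ltr_wpDr.
  by move: (k0); lra.
have i1s := Lfun2_integrable_mul f1L sL.
rewrite lee_fin expr1.
apply: (@le_trans _ _ (b * (3 * k * eps))); last first.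
  rewrite mulrA ler_wpM2r ?(ltW eps0)//.
  have -> : b * (3 * k) = r * (b / (b + 1)) by rewrite /k; field; rewrite gt_eqF.
  by rewrite ler_piMr ?(ltW r0)// ler_pdivrMr// mul1r lerDl.
apply: inner_dual_norm_le.
  exact: (mulr_ge0 b_ge0 (mulr_ge0 (mulr_ge0 (ler0n R 3) (ltW k0)) (ltW eps0))).
move=> w; rewrite !innerBl innerZl !inner_kernel_embedding// inner_derivative//.
(* The expansion needs a test function bounded everywhere, while [v] is bounded by [m] only almost
   everywhere; the two agree almost everywhere under both [P1] and [P]. *)
pose U z := clamp m (v (C z)).
have mU : measurable_fun setT U by exact: measurable_clamp.
have UP1 : {ae P1, forall z, U z = v (C z)}.
  by apply: filterS (model_ae M1 vm) => z; exact: clamp_id.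
have UP : {ae P, forall z, U z = v (C z)}.
  by apply: filterS vCm => z; exact: clamp_id.
have -> : \int[P1]_z (v (C z) * e w (C z)) = \int[P1]_z (U z * e w (C z)).
  by apply: ae_eq_lower_Rintegral; apply: filterS UP1 => z ->.
(* The integrand under [P] that replaces [v] under [P1] to first order. *)
pose g z := v (C z) * (1 + eps * s z).
have gL : g \in Lfun P 2%:E.
  apply: (Lfun2_bounded_mul (ltW m_gt0) mvC vCm).
  by apply: Lfun2_add; [exact: (Lfun_cst P 1 2)|exact: Lfun2_scale].
have eg : \int[P]_z (U z * e w (C z) * (1 + eps * s z)) =
          \int[P]_z (g z * e w (C z)).
  by apply: ae_eq_lower_Rintegral; apply: filterS UP => z ->; rewrite /g mulrAC.
have := qmd (fun z => U z * e w (C z)) (m * (b * `|w|)).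
rewrite eg => /(_ (measurable_funM mU (meC w))) h1.
have {}h1 : `|\int[P1]_z (U z * e w (C z)) - \int[P]_z (g z * e w (C z))| <=
            b * `|w| * (k * eps).
  have -> : b * `|w| * (k * eps) = m * (b * `|w|) * (k / m * eps).
    by field; rewrite gt_eqF.
  by apply: h1 => z; rewrite normrM ler_pM// clamp_le// ltW.
have fi : P.-integrable setT (EFin \o (fun z => f0 z + eps * (f1 z * s z))).
  by apply: integrable_add; [exact: Lfun2_integrable|exact: integrable_scale].
have ig := mul_e_integrable w gL.
have iu := mul_e_integrable w uC_Lfun2.
have ic := mul_e_integrable w (combine_Lfun2 sL tL).
have h2 : `|\int[P]_z (g z * e w (C z)) - \int[P]_z (u (C z) * e w (C z)) -
            eps * \int[P]_z (combine s t z * e w (C z))| <=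
          b * `|w| * (2 * k * eps).
  rewrite -RintegralZl// -RintegralB// -RintegralB//; last 2 first.
  - exact: integrable_sub.
  - exact: integrable_scale.
  (* What remains is the linear error [f0] of the path plus the product error [eps * f1 * s]. *)
  rewrite (_ : \int[P]_z _ =
      \int[P]_z ((f0 z + eps * (f1 z * s z)) * e w (C z))); last first.
    by apply: eq_Rintegral => z _; rewrite /g /combine /f0 /f1; ring.
  apply: (le_trans (Rintegral_mul_bounded_le fi (meC w)
    (fun z => e_le w (C z)))).
  rewrite ler_wpM2l ?mulr_ge0 ?b_ge0//.
  have j0 := integrable_norm (Lfun2_integrable f0L).
  have j1 := integrable_scale eps (integrable_norm i1s).
  apply: (@le_trans _ _ (\int[P]_z (`|f0 z| + eps * `|f1 z * s z|))).
    apply: le_Rintegral => //; first exact: (integrable_norm fi).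
      exact: integrable_add.
    move=> z _; rewrite (le_trans (ler_normD _ _))// normrM.
    by rewrite (gtr0_norm eps0).
  rewrite RintegralD// RintegralZl//; last exact: (integrable_norm i1s).
  have : eps * \int[P]_z `|f1 z * s z| <= eps * k by rewrite ler_wpM2l// ltW.
  lra.
set I1 := \int[P1]_z _ in h1 *; set I2 := \int[P]_z (g z * _) in h1 h2.
have -> : forall x y : R, I1 - x - y = (I1 - I2) + (I2 - x - y).
  by move=> x y; ring.
rewrite (le_trans (ler_normD _ _))// (le_trans (lerD h1 h2))//.
by rewrite le_eqVlt; apply/orP; left; apply/eqP; ring.
Unshelve. all: by end_near. Qed.

(** [e w] and the clamped density are versions of [ev w] and [phi] that are measurable and bounded
    everywhere, so the second component is a bounded function and hence a tangent direction. *)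
Definition adjoint w : (Z -> R) * (X -> R) :=
  (fun z => e w (C z) * u (C z) - \int[P]_z' (e w (C z') * u (C z')),
   fun x => e w x * clamp c (phi x)).

Let phiE : {ae qX, forall x, clamp c (phi x) = phi x}.
Proof.
apply: filterS phi_le => x h; rewrite clamp_id// ger0_norm//.
exact: (rn_density_ge0 pq).
Qed.

Let euL w : (fun z => e w (C z) * u (C z)) \in Lfun P 2%:E.
Proof.
apply: (Lfun2_bounded_mul (k := b * `|w|)) uC_Lfun2 => //.
  by rewrite mulr_ge0// b_ge0.
exact: aeW.
Qed.

Hypothesis M_nonparametric : locally_nonparametric M P.

Lemma tangent_space_mean0 s : tangent_space M P s -> \int[P]_z s z = 0.
Proof. by rewrite M_nonparametric => -[_]; rewrite /Rintegral => ->. Qed.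

Lemma adjoint_tangent w :
  sum_tangent M (Linfty_ball (distribution rho C) m) qX P u (adjoint w).
Proof.
split => /=.
  have fL : (fun z => e w (C z) * u (C z) -
      \int[P]_z' (e w (C z') * u (C z'))) \in Lfun P 2%:E.
    by apply: Lfun2_sub; [exact: euL|exact: (Lfun_cst P _ 2)].
  rewrite M_nonparametric; split => //.
  rewrite -[LHS]fineK; last exact/integrable_fin_num/(Lfun2_integrable fL).
  congr (_%:E); rewrite -/(Rintegral P setT _) RintegralB//.
  - by rewrite (Rintegral_prob_cst P) subrr.
  - exact: Lfun2_integrable (euL w).
  - exact: finite_measure_integrable_cst.
apply: (@bounded_in_L2_tangent_space _ _ _ _ _ _ _ _ m_gt0 U_u _ (b * `|w| * c)).
- exact/distribution_dominates/M_equivalent.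
- apply: measurable_funM; first exact: me.
  by apply: measurable_clamp; exact: (measurable_rn_density pq).
- move=> x; rewrite normrM ler_pM// clamp_le// (le_trans _ c_ge1)//.
Qed.

(** The centring constant pairs to 0 because tangent scores have mean zero; the density factor
    converts the pairing under [qX] into one under [P], the clamp being inactive almost
    everywhere. *)
Lemma inner_derivative_adjoint s t w : tangent_space M P s ->
  s \in Lfun P 2%:E -> t \in Lfun qX 2%:E ->
  inner (derivative (s, t)) w = sum_inner qX P (s, t) (adjoint w).
Proof.
move=> sT sL tL; rewrite inner_derivative// /sum_inner /=.
have tCL := Lfun2_comp tL.
have ie := mul_e_integrable w tCL.
have i1 := Lfun2_integrable_mul sL (euL w).
set kap := \int[P]_z' (e w (C z') * u (C z')).
have is_ := Lfun2_integrable sL.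
have -> : \int[P]_z (s z * (e w (C z) * u (C z) - kap)) =
          \int[P]_z (s z * (e w (C z) * u (C z))).
  transitivity (\int[P]_z (s z * (e w (C z) * u (C z)) - kap * s z)).
    by apply: eq_Rintegral => z _; ring.
  rewrite RintegralB//; last exact: integrable_scale.
  by rewrite RintegralZl// (tangent_space_mean0 sT) mulr0 subr0.
have -> : \int[qX]_x (t x * (e w x * clamp c (phi x))) =
          \int[P]_z (t (C z) * e w (C z)).
  have [mt _] := (LfunP2 _ _).1 tL.
  have mte : measurable_fun setT (fun x => t x * e w x).
    exact: measurable_funM.
  rewrite -(Rintegral_distribution (f := fun x => t x * e w x))//.
  rewrite (Rintegral_rn_density pq)//; last exact: integrable_distribution.
  apply: ae_eq_lower_Rintegral.
  by apply: filterS phiE => x ->; rewrite mulrA.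
rewrite -RintegralD//; apply: eq_Rintegral => z _.
by rewrite /combine; ring.
Qed.

End pathwise_differentiability.

(** * Constants for the density and the product norm, and the conclusion *)

Lemma rn_density_ae_le d (T : measurableType d) (R : realType)
    (nu mu : probability T R) : nu `<< mu ->
  ('N[mu]_+oo [Radon_Nikodym (charge_of_finite_measure nu) mu] < +oo)%E ->
  exists2 c : R, 1 <= c & {ae mu, forall x, rn_density nu mu x <= c}.
Proof.
move=> numu; set N := ('N[mu]_+oo [_])%E => Noo.
have N0 : (0 <= N)%E by exact: Lnorm_ge0.
have NE : N = (fine N)%:E by rewrite fineK// ge0_fin_numE.
(* The maximum with 1 secures [1 <= c], which the square estimates use. *)
exists (Num.max 1 (fine N)); first by rewrite le_max lexx.
have /Lnorm_infty_le h : (N <= (fine N)%:E)%E by rewrite -NE.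
apply: filterS2 h (ae_rn_density numu) => x.
rewrite -[Radon_Nikodym _ _ x]fineK; last exact: Radon_Nikodym_fin_num.
move=> + <-; rewrite lee_fin => h.
by rewrite le_max (le_trans (ler_norm _) h) orbT.
Qed.

Lemma sum_dist_lt d d' (Z : measurableType d) (X : measurableType d')
    (R : realType) (Q : probability X R) (P : probability Z R) s t s' t' (del : R) :
  s \in Lfun P 2%:E -> t \in Lfun Q 2%:E ->
  s' \in Lfun P 2%:E -> t' \in Lfun Q 2%:E ->
  sum_dist Q P (s, t) (s', t') < del ->
  (L2norm P (fun z => s z - s' z)%R <= del%:E)%E /\
  (L2norm Q (fun x => t x - t' x)%R <= del%:E)%E.
Proof.
move=> sL tL sL' tL' /ltW.
have fine_L2norm d0 (T : measurableType d0) (nu : probability T R) f :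
    f \in Lfun nu 2%:E -> (L2norm nu f = (fine (L2norm nu f))%:E)%E.
  move=> /andP[_]; rewrite inE => fL; rewrite fineK// ge0_fin_numE//.
  exact: Lnorm_ge0.
rewrite /sum_dist => h.
rewrite (fine_L2norm _ _ _ _ (Lfun2_sub sL sL')).
rewrite (fine_L2norm _ _ _ _ (Lfun2_sub tL tL')) !lee_fin; split;
  apply: le_trans h; rewrite -[leLHS]ger0_norm ?fine_ge0 ?Lnorm_ge0//;
  rewrite -sqrtr_sqr ler_wsqrtr//.
  by rewrite lerDl sqr_ge0.
by rewrite lerDr sqr_ge0.
Qed.

Theorem lemmaS11 (R : realType) (d d' : measure_display)
    (Z : measurableType d) (X : measurableType d')
    (C : {mfun Z >-> X})
    (M : set (probability Z R))
    (M_equivalent : forall P1 P2 : probability Z R, M P1 -> M P2 -> P1 `<< P2)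
    (rho : probability Z R) (M_rho : M rho)
    (K : X -> X -> R)
    (K_bounded : exists B : R, forall x y, `|K x y| <= B)
    (K_symmetric : forall x y, K x y = K y x)
    (K_posdef : posdef_kernel K)
    (W : rkhs K)
    (m : R) (m_gt0 : 0 < m)
    (Q : probability Z R) (M_Q : M Q)
    (theta_defined : forall P' u', M P' -> Linfty_ball (distribution rho C) m u' ->
       bochner_integrable (distribution P' C) (fun x => u' x *: ksec W x))
    (P : probability Z R) (M_P : M P)
    (u : X -> R) (U_u : Linfty_ball (distribution rho C) m u)
    (M_nonparametric : locally_nonparametric M P)
    (dPdQ_bounded :
       ('N[distribution Q C]_+oo
          [Radon_Nikodym (charge_of_finite_measure (distribution P C))
             (distribution Q C)] < +oo)%E) :
  exists (D : (Z -> R) * (X -> R) -> W) (Dstar : W -> (Z -> R) * (X -> R)),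
    [/\ is_total_derivative M (Linfty_ball (distribution rho C) m)
          (distribution Q C) P u (kernel_embedding W C) D,
        forall s t,
          sum_tangent M (Linfty_ball (distribution rho C) m)
            (distribution Q C) P u (s, t) ->
          is_bochner_integral P
            (fun z => (u (C z) * s z + t (C z)) *: ksec W (C z)) (D (s, t)) /\
          forall y, ev (D (s, t)) y =
            \int[P]_z (K y (C z) * (u (C z) * s z + t (C z))),
        is_adjoint M (Linfty_ball (distribution rho C) m)
          (distribution Q C) P u D Dstar,
        forall w, {ae P, forall z,
          (Dstar w).1 z = ev w (C z) * u (C z)
                          - \int[P]_z' (ev w (C z') * u (C z'))} &
        forall w, {ae distribution Q C, forall x,
          (Dstar w).2 x = ev w x *
            fine (Radon_Nikodym (charge_of_finite_measure (distribution P C))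
                    (distribution Q C) x)}].
Proof.
have [B KB] := K_bounded.
pose b := Num.sqrt B.
have kb : forall x, `|ksec W x| <= b by exact: norm_ksec_le.
have kL : ae_simple_limit (distribution rho C) (ksec W).
  (* The constant function [m] is a nonzero member of the ball, so its embedding at [rho] is
     defined. *)
  apply: (@ae_simple_limit_ksec _ _ _ _ _ _ m); first by rewrite gt_eqF.
  apply: (theta_defined rho (cst m) M_rho); apply/Linfty_ballP; split.
    exact: measurable_cst.
  by apply: aeW => x; rewrite gtr0_norm.
have [e [me eb eE]] := measurable_evaluations kL kb.
have pq : distribution P C `<< distribution Q C.
  exact/distribution_dominates/M_equivalent.
have [c c1 phic] := rn_density_ae_le pq dPdQ_bounded.
have tan p : sum_tangent M (Linfty_ball (distribution rho C) m)
    (distribution Q C) P u p ->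
    p.1 \in Lfun P 2%:E /\ p.2 \in Lfun (distribution Q C) 2%:E.
  by move=> [[? _] [? _]].
pose D := derivative C W P u.
pose Dstar := adjoint C e Q P u c.
exists D, Dstar; split.
- split.
  + move=> a [s t] [s' t'] /tan[/= sL tL] /tan[/= sL' tL'].
    exact: (derivative_linear M_equivalent M_rho kb kL me eb eE m_gt0 M_Q M_P
      U_u c1 phic).
  + move=> [s t] /tan[/= sL tL] r r0.
    have b0 : 0 <= b by exact: sqrtr_ge0.
    have mc0 : 0 <= b * (m + c).
      by rewrite mulr_ge0// addr_ge0// ?(ltW m_gt0)// (le_trans _ c1).
    (* The derivative has Lipschitz constant [b * (m + c)], which may be 0; the added 1 gives a
       positive divisor and a strict final inequality. *)
    have k0 : 0 < r / (b * (m + c) + 1) by rewrite divr_gt0// ltr_wpDl.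
    exists (r / (b * (m + c) + 1)) => // -[s' t'] /tan[/= sL' tL'].
    move=> /(sum_dist_lt sL tL sL' tL') [sdel tdel].
    apply: le_lt_trans.
      exact: (norm_derivative_sub_le M_equivalent M_rho kb kL me eb eE m_gt0
        M_Q M_P U_u c1 phic k0 sL tL sL' tL' sdel tdel).
    rewrite mulrA mulrCA -[ltRHS]mulr1 ltr_pM2l//.
    by rewrite ltr_pdivrMr ?ltr_wpDl// mul1r ltrDl.
  + move=> s t Pe ue [sL _] [tL _] sPe ueP.
    exact: (derivative_expansion M_equivalent M_rho kb kL me eb eE m_gt0 M_Q M_P
      U_u c1 phic sL tL sPe ueP).
- move=> s t /tan[/= sL tL]; split.
    exact: (is_bochner_integral_derivative M_equivalent M_rho kb kL m_gt0 M_Q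
      M_P U_u c1 phic sL tL).
  move=> y.
  exact: (ev_derivative M_equivalent M_rho kb kL me eb eE m_gt0 M_Q M_P U_u c1
    phic).
- move=> w; split.
    exact: (adjoint_tangent M_equivalent M_rho kb me eb m_gt0 M_Q M_P U_u c1
      M_nonparametric).
  move=> [s t] st; have [/= sL tL] := tan _ st; case: st => sT _.
  exact: (inner_derivative_adjoint M_equivalent M_rho kb kL me eb eE m_gt0 M_Q
    M_P U_u c1 phic M_nonparametric).
- move=> w; have h := model_ae M_equivalent M_rho M_P (eE w).
  have -> : \int[P]_z' (ev w (C z') * u (C z')) =
            \int[P]_z' (e w (C z') * u (C z')).
    by apply: ae_eq_lower_Rintegral; apply: filterS h => z ->.
  by apply: filterS h => z /= ->.
- move=> w.
  have h : {ae distribution Q C, forall x, e w x = ev w x}.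
    apply: ae_dominates (eE w).
    exact/distribution_dominates/M_equivalent.
  (* The density is nonnegative and almost everywhere at most [c], so clamping leaves it unchanged
     there. *)
  apply: filterS3 h phic (ae_rn_density pq) => x /= -> phix ->.
  by rewrite clamp_id// ger0_norm// rn_density_ge0.
Qed.
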